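(* (1) Let $b$ be a Baer subline of $\ell_\infty$ in $\mathrm{PG}(2,q^2)$, so that $[b]=\{[T]:\bar T\in b\}$ is a regulus contained in $\mathcal S$. Then every non-degenerate conic of $\Sigma_\infty$ contained in the point set of $[b]$ (i.e. the intersection of the point set of $[b]$ with a plane of $\Sigma_\infty$ containing no line of $[b]$) is a $g$-special conic. (2) Conversely, if $\mathcal C$ is a $g$-special conic contained in $\Sigma_\infty$, then the set of lines of $\mathcal S$ meeting $\mathcal C$ is a regulus, which is the unique regulus of $\mathcal S$ containing $\mathcal C$, and hence it equals $[b]$ for a Baer subline $b$ of $\ell_\infty$.
   Context: Bruck–Bose setting: $q$ a prime power; $\Sigma_\infty$ is a hyperplane of $\mathrm{PG}(4,q)$ and $\mathcal S$ a regular spread of $\Sigma_\infty$, whose lines $[T]$ correspond to the points $\bar T$ of $\ell_\infty$ of $\mathrm{PG}(2,q^2)$ (and affine points of $\mathrm{PG}(2,q^2)$ to points of $\mathrm{PG}(4,q)\setminus\Sigma_\infty$, lines other than $\ell_\infty$ to planes not in $\Sigma_\infty$ containing a spread line). Embedding $\mathrm{PG}(4,q)$ in $\mathrm{PG}(4,q^2)$, there are two unique conjugate lines $g,g^q$ of $\Sigma_\infty^\star\setminus\Sigma_\infty$ (the transversals of $\mathcal S$) such that each spread line extended, $[T]^\star$, is the line $TT^q$ where $T=[T]^\star\cap g$ and $T^q$ is its image under $x\mapsto x^q$ applied to coordinates. It is known that Baer sublines of $\ell_\infty$ correspond to reguli contained in $\mathcal S$. For a set $\mathcal V$ of $\mathrm{PG}(4,q)$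 defined by homogeneous equations over $\mathbb F_q$, $\mathcal V^\star$ denotes the set of points of $\mathrm{PG}(4,q^2)$ satisfying the same equations. A non-degenerate conic $\mathcal C$ of $\mathrm{PG}(4,q)$ is $g$-special if $\mathcal C^\star$ contains one point of $g$ and one point of $g^q$. *)

(* Defs.v *)
(* Model of Sigma_infinity = PG(3,q) inside PG(3,q^2).      *)
From HB Require Import structures.
From mathcomp Require Import all_boot all_order all_algebra all_field.
Set Implicit Arguments. Unset Strict Implicit. Unset Printing Implicit Defensive.
Import GRing.Theory.
Local Open Scope ring_scope.

(* K is GF(q^2) (we assume #|K| = q^2); GF(q) = {x | x^q = x}.              *)
(* Projective subspaces of PG(3,q^2) are represented by their canonical      *)
(* matrix <<U>>%MS : 'M[K]_4 (so that Leibniz equality = equality of          *)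
(* subspaces); a point is a subspace of rank 1, a line of rank 2, etc.       *)
Section Defs.
Variables (K : finFieldType) (q : nat).

Definition Fq : pred K := fun x => x ^+ q == x.

Definition frob (x : K) : K := x ^+ q.

Definition realmx m n (M : 'M[K]_(m, n)) : bool :=
  [forall i, forall j, Fq (M i j)].

Definition subsp (U : 'M[K]_4) : bool := <<U>>%MS == U.

Definition pt (U : 'M[K]_4) : bool := subsp U && (\rank U == 1)%N.

(* U = V* for a subspace V of PG(3,q) = Sigma_infinity: U is spanned by      *)
(* vectors with coordinates in GF(q).                                         *)
Definition realsub (U : 'M[K]_4) : bool :=
  subsp U && [exists M : 'M[K]_4, realmx M && (M == U)%MS].

Definition realpt (U : 'M[K]_4) : bool := realsub U && (\rank U == 1)%N.
Definition realline (U : 'M[K]_4) : bool := realsub U && (\rank U == 2)%N.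

Definition conjsp (U : 'M[K]_4) : 'M[K]_4 := <<map_mx frob U>>%MS.

Definition meet (U V : 'M[K]_4) : bool := (0 < \rank (U :&: V)%MS)%N.

Definition spread (S : {set 'M[K]_4}) : Prop :=
  (forall l, l \in S -> realline l) /\
  (forall P, realpt P -> exists! l, l \in S /\ (P <= l)%MS).

Definition regulus (R : {set 'M[K]_4}) : Prop :=
  #|R| = q.+1 /\
  (forall l, l \in R -> realline l) /\
  (forall l m, l \in R -> m \in R -> l != m -> ~~ meet l m) /\
  (forall m, realline m ->
     forall l1 l2 l3, l1 \in R -> l2 \in R -> l3 \in R ->
       l1 != l2 -> l1 != l3 -> l2 != l3 ->
       meet m l1 -> meet m l2 -> meet m l3 ->
       forall l, l \in R -> meet m l).

Definition regular_spread (S : {set 'M[K]_4}) : Prop :=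
  spread S /\
  forall l1 l2 l3, l1 \in S -> l2 \in S -> l3 \in S ->
    l1 != l2 -> l1 != l3 -> l2 != l3 ->
    exists R, regulus R /\ R \subset S /\ [/\ l1 \in R, l2 \in R & l3 \in R].

Definition g_transversal (S : {set 'M[K]_4}) (g : 'M[K]_4) : Prop :=
  [/\ subsp g, \rank g = 2%N, ~~ realsub g &
   forall l, l \in S ->
     exists T, [/\ pt T, (T == l :&: g)%MS & (l == T + conjsp T)%MS]].

(* Baer subline of the line g: {<a u + c v> : (a,c) in GF(q)^2 \ 0} where  *)
(* u, v span g.  (g plays the role of l_infinity via T-bar |-> T.)          *)
Definition baer_subline (g : 'M[K]_4) (b : {set 'M[K]_4}) : Prop :=
  exists u v : 'rV[K]_4, (col_mx u v == g)%MS /\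
    forall P, P \in b <->
      exists a c : K, [/\ Fq a, Fq c, (a, c) != (0, 0) &
                          P = <<a *: u + c *: v>>%MS].

Definition lines_of (S : {set 'M[K]_4}) (b : {set 'M[K]_4}) : {set 'M[K]_4} :=
  [set l in S | [exists T in b, (T <= l)%MS]].

(* Conics: a plane of Sigma_inf with GF(q)-basis the rows of B, and the     *)
(* quadratic form y |-> y A y^T on plane coordinates y, A over GF(q).        *)
Definition qf (A : 'M[K]_3) (y : 'rV[K]_3) : K := (y *m A *m y^T) 0 0.

(* non-degenerate: no (GF(q)-rational) singular point *)
Definition nondeg_conic (B : 'M[K]_(3, 4)) (A : 'M[K]_3) : Prop :=
  [/\ realmx B, \rank B = 3%N, realmx A &
   forall y : 'rV[K]_3, realmx y -> y != 0 -> qf A y = 0 ->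
     y *m (A + A^T) != 0].

Definition cpt (B : 'M[K]_(3, 4)) (A : 'M[K]_3) (P : 'M[K]_4) : bool :=
  [exists y : 'rV[K]_3,
     [&& realmx y, y != 0, qf A y == 0 & P == <<y *m B>>%MS]].

Definition cstar (B : 'M[K]_(3, 4)) (A : 'M[K]_3) (P : 'M[K]_4) : bool :=
  [exists y : 'rV[K]_3, [&& y != 0, qf A y == 0 & P == <<y *m B>>%MS]].

Definition g_special (g : 'M[K]_4) (B : 'M[K]_(3, 4)) (A : 'M[K]_3) : Prop :=
  (exists! T, [/\ pt T, (T <= g)%MS & cstar B A T]) /\
  (exists! T, [/\ pt T, (T <= conjsp g)%MS & cstar B A T]).

Definition lines_meeting (S : {set 'M[K]_4}) (B : 'M[K]_(3, 4)) (A : 'M[K]_3)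
  : {set 'M[K]_4} :=
  [set l in S | [exists P, cpt B A P && (P <= l)%MS]].

Definition conic_in (B : 'M[K]_(3, 4)) (A : 'M[K]_3) (R : {set 'M[K]_4}) : Prop :=
  forall P, cpt B A P -> exists2 l, l \in R & (P <= l)%MS.

End Defs.

(* Main.v *)
(* Write x' for the image of x under the Frobenius map t |-> t^q.  The lines g and
   g' are skew, so that the real vectors are the w + w' with w on g, and the spread
   consists of the lines L(w) = <w, w'>.  A real plane B meets g in one point <u>,
   and for suitable v on g it is spanned by u, u' and v + v'.  For a Baer subline b
   not containing <u>, the vectors u and v can be scaled so that b is the set of
   points <z' u + z v>; the points a u + a' u' + r (v + v') of B on the regulus are
   then those with a a' = r^2, a conic through <u> and <u'>.  Conversely, a conic of
   B through <u> has the equation k a a' + m r a + m' r a' + n r^2 = 0, which becomes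
   a a' = r^2 after translating v and scaling u.  What remains for the first half is
   that a non-degenerate conic contained in the regulus is a a' = r^2. *)
From HB Require Import structures.
Require Import Defs.
From mathcomp Require Import all_boot all_order all_fingroup all_algebra all_solvable all_field.
From mathcomp Require Import ring.
Set Implicit Arguments. Unset Strict Implicit. Unset Printing Implicit Defensive.
Import GRing.Theory.
Local Open Scope ring_scope.

(** * Finite fields of square order *)

(** The additive group of [K] is elementary abelian, so q^2, and hence q, is a power of the
    characteristic. This makes t |-> t^q additive. *)
Lemma card_square_pnat (K : finFieldType) (q : nat) :
  #|K| = (q ^ 2)%N -> [pchar K].-nat q.
Proof.
move=> hK; have [p p_pr charp] := finPcharP K.
have /abelem_pgroup := fin_ring_pchar_abelem charp.
by rewrite /pgroup cardsT hK pnatX (eq_pnat _ (pcharf_eq charp)) orbF.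
Qed.

Lemma frob_rmorphism (K : finFieldType) (q : nat) :
  #|K| = (q ^ 2)%N -> exists f : {rmorphism K -> K}, f =1 @frob K q.
Proof.
move=> /card_square_pnat qnat.
have fB : zmod_morphism (@frob K q).
  move=> x y; rewrite /frob exprDn_pchar //; congr (_ + _).
  by rewrite exprNn_pchar.
have fM : monoid_morphism (@frob K q).
  by split=> [|x y]; rewrite /frob ?expr1n ?exprMn.
pose fa := GRing.isZmodMorphism.Build K K (@frob K q) fB.
pose fm := GRing.isMonoidMorphism.Build K K (@frob K q) fM.
pose f : {rmorphism K -> K} := HB.pack (@frob K q) fa fm.
by exists f.
Qed.

Lemma frobK (K : finFieldType) (q : nat) :
  #|K| = (q ^ 2)%N -> involutive (@frob K q).
Proof. by move=> hK x; rewrite /frob -exprM mulnn -hK expf_card. Qed.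

(** The polynomial p = X^q - X divides X^(q^2) - X = p^q + p, a product of distinct linear factors
    over [K]; so p has q distinct roots in [K]. *)
Lemma card_Fq (K : finFieldType) (q : nat) :
  #|K| = (q ^ 2)%N -> #|[pred x : K | Fq q x]| = q.
Proof.
move=> hK; have q_gt1 : (1 < q)%N.
  by have := finNzRing_gt1 K; rewrite hK; case: (q) => [|[]].
have qnat := card_square_pnat hK.
pose p : {poly K} := 'X^q - 'X.
have sz_p : size p = q.+1 by rewrite size_polyDl size_polyXn // size_polyN size_polyX.
have : p %| \prod_(x <- enum K) ('X - x%:P).
  rewrite big_enum -finField_genPoly hK.
  have -> : 'X^(q ^ 2) - 'X = p ^+ q + p :> {poly K}.
    rewrite /p exprDn_pchar; last by rewrite (eq_pnat _ (pchar_poly _)).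
    rewrite exprNn_pchar -?exprM ?mulnn; last by rewrite (eq_pnat _ (pchar_poly _)).
    by rewrite addrA subrK.
  by rewrite dvdp_add ?dvdpp // -(prednK (ltnW q_gt1)) exprS dvdp_mulr.
case/dvdp_prod_XsubC => m pE.
have um : uniq (mask m (enum K)) by rewrite mask_uniq ?enum_uniq.
have := eqp_size pE; rewrite sz_p size_prod_XsubC => -[szm].
rewrite [RHS]szm -(card_uniqP um); apply: eq_card => x.
have := eqp_root pE x; rewrite root_prod_XsubC => <-.
by rewrite !inE rootE !hornerE subr_eq0.
Qed.

(** For [i = 0] the sum is q, which is 0 in [K]. Otherwise x^i = 1 has fewer than q - 1 roots, so
    some nonzero c of GF(q) has c^i != 1; multiplication by c permutes GF(q) and multiplies the sum
    by c^i. *)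
Lemma sum_Fq_expr (K : finFieldType) (q : nat) (i : nat) :
  #|K| = (q ^ 2)%N -> (i < q.-1)%N -> \sum_(x : K | Fq q x) x ^+ i = 0.
Proof.
move=> hK lti; have qnat := card_square_pnat hK.
have q_gt0 : (0 < q)%N by case: (q) lti.
have [c /andP[Fc c0] ci] : exists2 c : K, Fq q c && (c != 0) & (i == 0%N) || (c ^+ i != 1).
  have [->|i0] := posnP i.
    by exists 1; rewrite // /Fq expr1n eqxx oner_eq0.
  apply/exists_inP; apply: contraTT lti; rewrite negb_exists_in -leqNgt => /forall_inP all1.
  have -> : q.-1 = #|[pred x : K | Fq q x && (x != 0)]|.
    have := cardD1 0 [pred x : K | Fq q x].
    rewrite card_Fq // inE /= /Fq expr0n eqn0Ngt q_gt0 eqxx add1n.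
    move=> /(congr1 predn) -> /=.
    by apply: eq_card => x; rewrite !inE /Fq andbC.
  rewrite cardE; apply: max_unity_roots => //; last exact: enum_uniq.
  apply/allP=> x; rewrite mem_enum inE => /all1.
  by rewrite /= negbK unity_rootE.
case/orP: ci => [/eqP->|ci].
  rewrite (eq_bigr (fun=> 1)) // sumr_const card_Fq //.
  have [p p_pr charp] := finPcharP K.
  move: qnat; rewrite (eq_pnat _ (pcharf_eq charp)) => /p_natP[[|k] qE].
    by rewrite qE in lti.
  by rewrite qE expnS mulrnA pcharf0 ?mul0rn.
set s := LHS; have : c ^+ i * s = s.
  rewrite {2}/s (reindex_onto ( *%R c) ( *%R c^-1)) => [|x _]; last by rewrite mulVKf.
  rewrite mulr_sumr; apply: eq_big => [x|x _]; last by rewrite exprMn.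
  rewrite mulKf // eqxx andbT /Fq exprMn (eqP Fc).
  by rewrite (inj_eq (mulfI c0)).
move/eqP; rewrite -subr_eq0 -{2}(mul1r s) -mulrBl mulf_eq0 subr_eq0 (negPf ci).
by move/eqP.
Qed.

Lemma qfE (K : finFieldType) (A : 'M[K]_3) y :
  qf A y = \sum_i \sum_j A i j * y 0 i * y 0 j.
Proof.
rewrite /qf mxE exchange_big; apply: eq_bigr => j _; rewrite mxE mulr_suml.
by apply: eq_bigr => i _; rewrite !mxE; ring.
Qed.

(* The Chevalley-Warning argument: [qf A y ^+ q.-1] is the indicator of
   [qf A y != 0], and its sum over GF(q)^3 vanishes because it has degree
   2(q - 1) < 3(q - 1). *)
Lemma ternary_form_isotropic (K : finFieldType) (q : nat) (A : 'M[K]_3) :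
  #|K| = (q ^ 2)%N -> Defs.realmx q A ->
  exists y, [/\ Defs.realmx q y, y != 0 & qf A y = 0].
Proof.
move=> hK /forallP rA; have qnat := card_square_pnat hK.
have q_gt1 : (1 < q)%N.
  by have := finNzRing_gt1 K; rewrite hK; case: (q) => [|[]].
have Fq0 : Fq q (0 : K) by rewrite /Fq expr0n eqn0Ngt (ltnW q_gt1).
pose Y (f : {ffun 'I_3 -> K}) : 'rV[K]_3 := \row_i f i.
have sum0 : \sum_(f in ffun_on (Fq q)) qf A (Y f) ^+ q.-1 = 0.
  pose F (f : {ffun 'I_3 -> K}) (p : 'I_3 * 'I_3) := A p.1 p.2 * (f p.1 * f p.2).
  have qfY f : qf A (Y f) = \sum_p F f p.
    rewrite qfE pair_big; apply: eq_bigr => p _.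
    by rewrite /F !mxE mulrA.
  under eq_bigr => f _.
    rewrite qfY -[q.-1]card_ord -prodr_const bigA_distr_bigA.
  over.
  rewrite exchange_big big1 // => h _.
  under eq_bigr => f _ do rewrite big_split.
  rewrite -mulr_sumr.
  (* [h] picks one monomial from each of the q - 1 factors, and [e i] is the exponent of the i-th
     variable in their product. *)
  pose e i := (#|[pred k | (h k).1 == i]| + #|[pred k | (h k).2 == i]|)%N.
  have prodE (f : {ffun 'I_3 -> K}) :
      \prod_(k < q.-1) (f (h k).1 * f (h k).2) = \prod_i f i ^+ e i :> K.
    rewrite big_split /e.
    have half (a : 'I_q.-1 -> 'I_3) :
        \prod_k f (a k) = \prod_i f i ^+ #|[pred k | a k == i]|.
      rewrite (partition_big a predT) //=; apply: eq_bigr => i _.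
      by rewrite -prodr_const; apply: eq_bigr => k /eqP->.
    by rewrite !half -big_split; apply: eq_bigr => i _; rewrite exprD.
  rewrite (eq_bigr (fun f : {ffun 'I_3 -> K} => \prod_i f i ^+ e i)) => [|f _]; last exact: prodE.
  rewrite -(bigA_distr_big (Fq q) (fun i x => x ^+ e i)).
  (* The three exponents add up to 2(q - 1), so one of them is below q - 1 and the corresponding
     one-variable sum vanishes. *)
  have [i ei] : exists i, (e i < q.-1)%N.
    apply/existsP; apply: contraTT q_gt1; rewrite negb_exists => /forallP ge_e.
    have : (\sum_i e i = q.-1 * 2)%N.
      have half (a : 'I_q.-1 -> 'I_3) : (\sum_i #|[pred k | a k == i]| = q.-1)%N.
        rewrite -[RHS]card_ord -sum1_card (partition_big a predT) //=.
        by apply: eq_bigr => i _; rewrite -sum1_card.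
      by rewrite /e big_split /= !half muln2 addnn.
    have : (\sum_(i < 3) q.-1 <= \sum_i e i)%N.
      by apply: leq_sum => i _; rewrite leqNgt.
    rewrite sum_nat_const card_ord => le3 e2; move: le3; rewrite e2 mulnC.
    by rewrite leq_mul2l /= orbF; case: (q) => [|[]].
  by rewrite (bigD1 i) //= sum_Fq_expr // mul0r mulr0.
have [/existsP[y /and3P[ry y0 /eqP yA]]|] :=
    boolP [exists y, [&& Defs.realmx q y, y != 0 & qf A y == 0]].
  by exists y.
rewrite negb_exists => /forallP noz.
(* Without a nontrivial zero the summand is 1 except at the origin, so the sum would be q^3 - 1 =
   -1. *)
suff : \sum_(f in ffun_on (Fq q)) qf A (Y f) ^+ q.-1 = -1.
  by move/eqP; rewrite sum0 eq_sym oppr_eq0 oner_eq0.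
have [phi phiE] := frob_rmorphism hK.
have pow f : f \in ffun_on (Fq q) -> qf A (Y f) ^+ q.-1 = 1 - (f == [ffun=> 0])%:R.
  move/ffun_onP => Ff; case: eqP => [->|f0].
    rewrite subrr qfE big1 ?expr0n; first by rewrite eqn0Ngt -ltnS prednK ?(ltnW q_gt1) // q_gt1.
    by move=> i _; rewrite big1 // => j _; rewrite /Y !mxE !ffunE mulr0.
  rewrite subr0; have Yf0 : Y f != 0.
    apply/eqP=> Y0; apply: f0; apply/ffunP=> i; rewrite ffunE.
    by have := congr1 (fun M : 'rV_3 => M 0 i) Y0; rewrite !mxE.
  have rY : Defs.realmx q (Y f).
    by apply/forallP=> i; apply/forallP=> j; rewrite mxE; exact: Ff.
  have := noz (Y f); rewrite rY Yf0 /= => qf0; apply: (mulfI qf0).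
  rewrite mulr1 -exprS prednK ?(ltnW q_gt1) // -[LHS]phiE qfE rmorph_sum.
  apply: eq_bigr => i _; rewrite rmorph_sum; apply: eq_bigr => j _.
  rewrite !mxE !rmorphM !phiE /frob (eqP (Ff i)) (eqP (Ff j)).
  by have /forallP/(_ j)/eqP-> := rA i.
rewrite (eq_bigr _ pow) sumrB sumr_const card_ffun_on card_Fq // card_ord.
have q0 : q%:R = 0 :> K.
  have <- : \sum_(x : K | Fq q x) x ^+ 0 = 0.
    by apply: sum_Fq_expr => //; rewrite -ltnS prednK // (ltnW q_gt1).
  by rewrite sumr_const card_Fq.
rewrite natrX q0 expr0n sub0r (bigD1 [ffun=> 0]) /= ?eqxx; last first.
  by apply/ffun_onP=> i; rewrite ffunE.
by rewrite big1 ?addr0 // => f /andP[_ /negPf->].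
Qed.

(** * Norms, traces and forms over the fixed field of an involution *)

Section Involution.
Variables (K : finFieldType) (f : {rmorphism K -> K}).
Hypothesis fK : involutive f.
Variable th : K.
Hypothesis fth : f th != th.

Lemma skew_exists : exists2 d : K, d != 0 & f d = - d.
Proof.
exists (th - f th); first by rewrite subr_eq0 eq_sym.
by rewrite rmorphB fK opprB.
Qed.

(** In odd characteristic 1 has nonzero trace; in characteristic 2 a zero trace means being fixed,
    which [th] is not. *)
Lemma trace_exists : exists a : K, a + f a != 0.
Proof.
have [two0|two_neq0] := eqVneq (1 + 1 : K) 0; last by exists 1; rewrite rmorph1.
exists th; apply: contra fth => /eqP tr0; apply/eqP/subr0_eq.
have -> : f th - th = (th + f th) - (1 + 1) * th by ring.
by rewrite tr0 two0 mul0r subrr.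
Qed.

(* Hilbert 90: [a := z + f x * f z] works for a suitable [z]. *)
Lemma hilbert90 x : x * f x = 1 -> exists2 a, a != 0 & f a = x * a.
Proof.
move=> Nx; have fa z : f (z + f x * f z) = x * (z + f x * f z).
  by rewrite rmorphD rmorphM !fK mulrDr mulrA Nx mul1r addrC.
have [x1|] := eqVneq (1 + f x * f 1) 0; last by exists (1 + f x * f 1).
have fxE : f x = -1 by move: x1; rewrite rmorph1 mulr1 addrC => /eqP; rewrite addr_eq0 => /eqP.
exists (th + f x * f th); last exact: fa.
by rewrite fxE mulN1r subr_eq0 eq_sym.
Qed.

(** Cramer's rule for z = s + t th and its conjugate z' = s + t th'. *)
Lemma real_coords z :
  exists s t, [/\ f s = s, f t = t & z = s + t * th].
Proof.
have d0 : th - f th != 0 by rewrite subr_eq0 eq_sym.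
exists ((th * f z - f th * z) / (th - f th)), ((z - f z) / (th - f th)); split.
- rewrite !fmorph_div !rmorphB !rmorphM !fK /=.
  by rewrite -[f th - th]opprB invrN mulrN -mulNr; congr (_ / _); ring.
- by rewrite fmorph_div !rmorphB !fK -[f th - th]opprB -[f z - z]opprB invrN mulrNN.
- by field.
Qed.

Section CircleForm.
Variables e k m n : K.
Hypotheses (fk : f k = k) (fn : f n = n).

(** The form of a conic at the real point a u + a' u' + r (v + v') of its plane, for r in GF(q); see
    [qf_plane_vec]. *)
Let Q a r := e * a ^+ 2 + f e * f a ^+ 2 + k * (a * f a)
  + r * (m * a + f m * f a) + n * r ^+ 2.

(* If [c] below were zero, (1, 1) would be a singular point of [Q].
   Projecting the conic from (1, 1) shows that off the line [a + f a = 0]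
   the form [Q a 0] is [c * (a * f a)]. *)
Lemma circle_form_coef0 :
  (forall a r, f r = r -> (a != 0) || (r != 0) -> Q a r = 0 -> a * f a = r ^+ 2) ->
  Q 1 1 = 0 -> e + e + k + m != 0 -> e = 0.
Proof.
move=> zeroQ Q11 c0; set c := e + e + k + m in c0.
have anis a : a != 0 -> Q a 0 != 0.
  move=> a0; apply/eqP => /zeroQ; rewrite rmorph0 a0 expr0n => /(_ erefl isT)/eqP.
  by rewrite mulf_eq0 fmorph_eq0 orbb (negPf a0).
have fQ a : f (Q a 0) = Q a 0.
  by rewrite /Q !(rmorphD, rmorphM, rmorphXn) !fK rmorph0 fk fn; ring.
(* [t] is the polar form of (1, 1) and (a, 0), and [s] is Q at (a, 0), so the line joining these two
   points meets the conic again in t (a, 0) - s (1, 1). The identity is a a' = r^2 at that point,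
   divided by t. *)
have proj a : c * a + f c * f a != 0 ->
    a * f a * (c * a + f c * f a) = Q a 0 * (a + f a).
  set t := c * a + f c * f a => t0.
  have a0 : a != 0 by apply: contraNneq t0 => a0; rewrite /t a0 rmorph0 !mulr0 addr0.
  have ft : f t = t by rewrite /t rmorphD !rmorphM !fK addrC.
  have s0 := anis a a0; set s := Q a 0 in s0 *.
  have fs : f s = s := fQ a.
  have : Q (a * t - s) (- s) = 0.
    have -> : Q (a * t - s) (- s) = t ^+ 2 * Q a 0
        - t * s * ((e + e + k + m) * a + (f e + f e + k + f m) * f a) + s ^+ 2 * Q 1 1.
      by rewrite /Q rmorph1 rmorphB rmorphM ft fs; ring.
    have -> : (e + e + k + m) * a + (f e + f e + k + f m) * f a = t.
      by rewrite /t /c !rmorphD fk.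
    rewrite Q11 -/s; ring.
  move/zeroQ; rewrite rmorphN fs oppr_eq0 s0 orbT => /(_ erefl isT).
  rewrite rmorphB rmorphM ft fs => E.
  apply: (mulfI t0); apply: subr0_eq.
  by rewrite -(subrr (s ^+ 2)) -{1}[s ^+ 2]sqrrN -E; ring.
have [d d0 fd] := skew_exists.
(* [d] has trace 0, so for c not fixed [proj] would give d d' (c - c') d = 0. *)
have fc : f c = c.
  apply: contraTeq isT => fc; have := proj d; rewrite fd subrr mulr0.
  have -> : c * d + f c * - d = (c - f c) * d by ring.
  have ncd : (c - f c) * d != 0 by rewrite mulf_neq0 // subr_eq0 eq_sym.
  move/(_ ncd)/eqP; rewrite mulf_eq0 (negPf ncd) orbF mulrN oppr_eq0 mulf_eq0.
  by rewrite (negPf d0).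
pose D a := e * a ^+ 2 + f e * f a ^+ 2 + (k - c) * (a * f a).
have D0 a : a + f a != 0 -> D a = 0.
  move=> tr0; have := proj a; rewrite fc -mulrDr mulf_neq0 // => /(_ isT).
  rewrite mulrA => /(mulIf tr0) E; apply: subr0_eq.
  transitivity (Q a 0 - a * f a * c); first by rewrite /Q /D; ring.
  by rewrite E subrr.
(* All a + t d with t in GF(q) have the same trace, and D is quadratic in t along them with leading
   coefficient D d; three values of t force it to vanish. When GF(q) has only the elements 0 and 1,
   [c], [d] and [Q d 0] are all 1. *)
have Dd : D d = 0.
  have [/existsP[s /and3P[/eqP fs s0 s1]]|] := boolP [exists s, [&& f s == s, s != 0 & s != 1]].
    have [a a0] := trace_exists.
    have tr t : f t = t -> D (a + t * d) = 0.
      move=> ft; apply: D0; rewrite rmorphD rmorphM ft fd.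
      by have -> : a + t * d + (f a + t * - d) = a + f a by ring.
    have : (s - s ^+ 2) * D d = s * D (a + 1 * d) - D (a + s * d) - (s - 1) * D (a + 0 * d).
      by rewrite /D !rmorphD !rmorphM fs fd rmorph0 rmorph1; ring.
    rewrite !tr ?rmorph0 ?rmorph1 // !mulr0 !subrr => /eqP.
    have -> : s - s ^+ 2 = s * (1 - s) by ring.
    by rewrite !mulf_eq0 (negPf s0) subr_eq0 eq_sym (negPf s1) => /eqP.
  rewrite negb_exists => /forallP only1.
  have one s : f s = s -> s != 0 -> s = 1.
    by move=> fs s0; have := only1 s; rewrite fs eqxx s0 negbK => /eqP.
  have two0 : (1 + 1 : K) = 0.
    apply: contraTeq isT => /one; rewrite rmorphD rmorph1 => /(_ erefl) /eqP.
    by rewrite -subr_eq0 addrK oner_eq0.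
  have d1 : d = 1.
    apply: one => //; rewrite fd; apply/eqP; rewrite eq_sym -addr_eq0 -(mulr1 d).
    by rewrite -mulrDr two0 mulr0.
  have c1 := one c fc c0; have q1 := one _ (fQ d) (anis d d0).
  transitivity (Q d 0 - c); last by rewrite q1 c1 subrr.
  by rewrite /D /Q d1 rmorph1; ring.
(* The elements of trace 0 are the GF(q)-multiples of [d]. *)
have DE a : D a = 0.
  have [tr0|] := eqVneq (a + f a) 0; last exact: D0.
  have ft : f (a / d) = a / d.
    by rewrite fmorph_div fd -[f a](addKr a) tr0 addr0 invrN mulrNN.
  have -> : D a = (a / d) ^+ 2 * D d.
    by move: (a / d) ft (divfK d0 a) => t ft <-; rewrite /D rmorphM ft; ring.
  by rewrite Dd mulr0.
have j1 : k - c = - (e + f e).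
  by have := DE 1; rewrite /D rmorph1 !expr1n !mulr1 => /eqP; rewrite addrC addr_eq0 => /eqP.
(* By D 1 = 0, D a factors as (a - a')(e a - e' a'). Comparing [th] with [th + 1] then yields e =
   e', and hence e = 0. *)
have lin a : f a != a -> e * a = f e * f a.
  move=> fa; apply: subr0_eq.
  have : (a - f a) * (e * a - f e * f a) = D a by rewrite /D j1; ring.
  by rewrite DE => /eqP; rewrite mulf_eq0 subr_eq0 eq_sym (negPf fa) => /eqP.
have l0 := lin th fth; have l1 : e * (th + 1) = f e * (f th + 1).
  by rewrite lin ?rmorphD ?rmorph1 // (inj_eq (addIr _)).
have ee : e = f e.
  by move: l1; rewrite !mulrDr l0 !mulr1 => /addrI.
apply/eqP; have : e * (th - f th) = 0 by rewrite mulrBr l0 -ee subrr.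
by move/eqP; rewrite mulf_eq0 subr_eq0 [th == _]eq_sym (negPf fth) orbF.
Qed.
End CircleForm.
End Involution.

(** * The spread and its transversals *)

Lemma sub_rV2P (F : fieldType) n (x u v : 'rV[F]_n) :
  reflect (exists a b, x = a *: u + b *: v) (x <= u + v)%MS.
Proof.
apply: (iffP sub_addsmxP) => [[[a b] ->]|[a [b ->]]].
  by exists (a 0 0), (b 0 0); rewrite /= {1}[a]mx11_scalar {1}[b]mx11_scalar !mul_scalar_mx.
by exists (a%:M, b%:M); rewrite /= !mul_scalar_mx.
Qed.

Lemma rank1_genmx (F : fieldType) n (T : 'M[F]_n) :
  \rank T = 1%N -> exists2 w : 'rV_n, w != 0 & (T == w)%MS.
Proof.
move=> rT; have T0 : T != 0 by rewrite -mxrank_eq0 rT.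
exists (nz_row T); first by rewrite nz_row_eq0.
by rewrite andbC -mxrank_leqif_eq ?nz_row_sub // rank_rV nz_row_eq0 T0 rT.
Qed.

Section Spread.
Variables (K : finFieldType) (q : nat) (f : {rmorphism K -> K}).
Hypotheses (fE : f =1 frob q) (fK : involutive f).
Variable th : K.
Hypothesis fth : f th != th.
Variables (S : {set 'M[K]_4}) (g : 'M[K]_4).
Hypotheses (hS : spread q S) (hg : g_transversal q S g).

Local Notation conj := (map_mx f).

Lemma Fq_fix x : Fq q x = (f x == x).
Proof. by rewrite fE. Qed.

Lemma realmxP m n (M : 'M[K]_(m, n)) : reflect (conj M = M) (Defs.realmx q M).
Proof.
apply: (iffP forallP) => [rM|rM i].
  by apply/matrixP=> i j; have /forallP/(_ j) := rM i; rewrite Fq_fix mxE => /eqP.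
by apply/forallP=> j; rewrite Fq_fix -{2}rM mxE.
Qed.

Lemma conjspE (U : 'M[K]_4) : conjsp q U = <<conj U>>%MS.
Proof. by congr <<_>>%MS; apply/matrixP=> i j; rewrite !mxE fE. Qed.

Lemma map_mx_invol m n (M : 'M[K]_(m, n)) : conj (conj M) = M.
Proof. by apply/matrixP=> i j; rewrite !mxE fK. Qed.

Lemma real_subc m1 m2 n (M : 'M[K]_(m1, n)) (N : 'M[K]_(m2, n)) :
  conj N = N -> (conj M <= N)%MS = (M <= N)%MS.
Proof. by move=> rN; rewrite -{1}rN map_submx. Qed.

(** The canonical form makes equality of spread lines a Leibniz equality, as membership in [S]
    requires. *)
Definition conj_span (w : 'rV[K]_4) : 'M[K]_4 := <<(w + conj w)%MS>>%MS.
Local Notation L := conj_span.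

Lemma conj_spanP (w x : 'rV[K]_4) :
  reflect (exists a b, x = a *: w + b *: conj w) (x <= L w)%MS.
Proof. by rewrite genmxE; apply: sub_rV2P. Qed.

Lemma spread_conj_span l : l \in S -> exists w, [/\ (w <= g)%MS, w != 0 & l = L w].
Proof.
move=> lS; have [_ _ _ /(_ l lS)[T [ptT Tlg lT]]] := hg.
have [lreal _] := hS; have /andP[/andP[/eqP sl _] _] := lreal l lS.
have /andP[_ /eqP rT] := ptT; have [w w0 Tw] := rank1_genmx rT.
exists w; split=> //.
  apply: (submx_trans _ (capmxSr l g)).
  by rewrite -(eqmxP Tlg) (eqmxP Tw).
rewrite -sl; apply/genmxP; apply/eqmxP; apply: (eqmx_trans (eqmxP lT)).
rewrite conjspE; apply: adds_eqmx; first exact/eqmxP.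
apply: (eqmx_trans (genmxE _)); apply/eqmxP.
rewrite !map_submx; exact: Tw.
Qed.

Lemma real_multiple (x : 'rV[K]_4) : x != 0 ->
  exists a, a *: x + conj (a *: x) != 0.
Proof.
move=> x0; have [x1|] := eqVneq (x + conj x) 0; last by exists 1; rewrite scale1r.
exists th; rewrite map_mxZ; have -> : conj x = - x by apply/eqP; rewrite -addr_eq0 addrC x1.
by rewrite scalerN -scalerBl scaler_eq0 (negPf x0) orbF subr_eq0 eq_sym.
Qed.

Lemma pt_genmx (x : 'rV[K]_4) : x != 0 -> pt <<x>>%MS.
Proof. by move=> x0; rewrite /pt /subsp genmx_id eqxx mxrank_gen rank_rV x0. Qed.

Lemma realpt_genmx (x : 'rV[K]_4) : x != 0 -> conj x = x -> realpt q <<x>>%MS.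
Proof.
move=> x0 rx; rewrite /realpt /realsub; have /andP[-> ->] := pt_genmx x0.
rewrite andbT; apply/existsP; exists (\matrix_i x).
have rowE (i : 'I_4) : row i (\matrix_(j < 4) x) = x by rewrite rowK.
apply/andP; split; first by apply/realmxP/row_matrixP=> i; rewrite -map_row rowE.
apply/andP; split; first by apply/row_subP=> i; rewrite rowE genmxE.
by rewrite genmxE -{1}(rowE ord0) row_sub.
Qed.

Lemma spread_cover (x : 'rV[K]_4) : x != 0 -> conj x = x -> exists2 l, l \in S & (x <= l)%MS.
Proof.
move=> x0 rx; have [_ /(_ _ (realpt_genmx x0 rx))[l [[lS xl] _]]] := hS.
by exists l => //; rewrite genmxE in xl.
Qed.

(* A point of [g] lying on the conjugate of [g] yields a GF(q)-rational point
   of [g]; the spread line through it would meet [g] only there, hence be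
   spanned by a single point. *)
Lemma transversal_disjoint (x : 'rV[K]_4) : (x <= g)%MS -> (conj x <= g)%MS -> x = 0.
Proof.
move=> xg xcg; apply: contraTeq isT => x0; have [a s0] := real_multiple x0.
set s := _ + _ in s0; have rs : conj s = s by rewrite map_mxD map_mx_invol addrC.
have sg : (s <= g)%MS by rewrite addmx_sub ?map_mxZ ?scalemx_sub.
have [l lS sl] := spread_cover s0 rs.
have [_ _ _ /(_ l lS)[T [/andP[_ /eqP rT] Tlg lT]]] := hg.
have sT : (s == T)%MS.
  by rewrite -mxrank_leqif_eq ?rank_rV ?s0 ?rT // (eqmxP Tlg) sub_capmx sl.
have [lreal _] := hS; have /andP[_ /eqP rl] := lreal l lS.
have : (l <= s)%MS.
  rewrite (eqmxP lT) conjspE addsmx_sub genmxE (andP sT).2 /=.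
  by rewrite -rs map_submx (andP sT).2.
by move/mxrankS; rewrite rl rank_rV s0.
Qed.

(** Such an x lies on g and on its conjugate, which are skew by [transversal_disjoint]. *)
Lemma transversal_direct (x y : 'rV[K]_4) :
  (x <= g)%MS -> (y <= g)%MS -> x + conj y = 0 -> x = 0 /\ y = 0.
Proof.
move=> xg yg /eqP; rewrite addr_eq0 => /eqP xE.
have x0 : x = 0.
  by apply: transversal_disjoint => //; rewrite xE map_mxN map_mx_invol -scaleN1r scalemx_sub.
split=> //; apply: (can_inj (@map_mx_invol _ _)); apply/eqP.
by rewrite map_mx0 -oppr_eq0 -xE x0.
Qed.

Lemma transversal_inj (x y z t : 'rV[K]_4) :
  (x <= g)%MS -> (y <= g)%MS -> (z <= g)%MS -> (t <= g)%MS ->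
  x + conj y = z + conj t -> x = z /\ y = t.
Proof.
move=> xg yg zg tg E.
have := @transversal_direct (x - z) (y - t).
rewrite !addmx_sub -?scaleN1r ?scalemx_sub // !scaleN1r map_mxB => /(_ isT isT).
rewrite addrACA E -opprD subrr => /(_ erefl)[/eqP + /eqP].
by rewrite !subr_eq0 => /eqP-> /eqP->.
Qed.

Lemma conj_spanZ a w : a != 0 -> L (a *: w) = L w.
Proof.
move=> a0; apply/genmxP/eqmxP; apply: adds_eqmx; first exact: eqmx_scale.
by rewrite map_mxZ; apply: eqmx_scale; rewrite fmorph_eq0.
Qed.

Lemma conj_span_coef w x y : (w <= g)%MS -> (x <= g)%MS -> (y <= g)%MS ->
  ((x + conj y)%R <= L w)%MS -> exists a b, x = a *: w /\ y = b *: w.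
Proof.
move=> wg xg yg /conj_spanP [a [b E]]; exists a, (f b).
by apply: transversal_inj; rewrite ?scalemx_sub // map_mxZ fK.

Qed.

(** The spread line covering the real point w + w' is some L(v), and comparing components in g makes
    w proportional to v. *)
Lemma conj_span_spread w : (w <= g)%MS -> w != 0 -> L w \in S.
Proof.
move=> wg w0; have s0 : w + conj w != 0.
  by apply: contra_neq w0 => /(transversal_direct wg wg)[].
have [|l lS] := spread_cover s0; first by rewrite map_mxD map_mx_invol addrC.
have [v [vg v0 lE]] := spread_conj_span lS; rewrite lE in lS *.
move/(conj_span_coef vg wg wg) => [a [_ [wE _]]].
by rewrite wE conj_spanZ //; apply: contraNneq w0 => a0; rewrite wE a0 scale0r.
Qed.

Lemma spread_line_eq x y l : (x <= g)%MS -> (y <= g)%MS -> x != 0 ->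
  l \in S -> ((x + conj y)%R <= l)%MS -> l = L x.
Proof.
move=> xg yg x0 lS; have [w [wg w0 ->]] := spread_conj_span lS.
move=> /(conj_span_coef wg xg yg)[a [_ [xE _]]].
by rewrite xE conj_spanZ //; apply: contraNneq x0 => a0; rewrite xE a0 scale0r.
Qed.

(** Since g has rank 2, a spanning pair is a basis of it. *)
Definition frame (u v : 'rV[K]_4) := (col_mx u v == g)%MS.

Lemma frameP u v x : frame u v ->
  reflect (exists a b, x = a *: u + b *: v) (x <= g)%MS.
Proof.
move=> /eqmxP uvg; rewrite -(uvg).2 -addsmxE; exact: sub_rV2P.
Qed.

Lemma frame_sub u v : frame u v -> (u <= g)%MS /\ (v <= g)%MS.
Proof.
move=> uv; split; apply/(frameP _ uv); first by exists 1, 0; rewrite scale1r scale0r addr0.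
by exists 0, 1; rewrite scale1r scale0r add0r.
Qed.

Lemma frame_comb u v a b : frame u v -> ((a *: u + b *: v)%R <= g)%MS.
Proof. by move=> uv; apply/(frameP _ uv); exists a, b. Qed.

Lemma frame_free u v a b : frame u v -> a *: u + b *: v = 0 -> a = 0 /\ b = 0.
Proof.
move=> uv; have [_ rg _ _] := hg.
have free_uv : row_free (col_mx u v) by rewrite /row_free (eqmxP uv) rg.
rewrite -!mul_scalar_mx -mul_row_col => /eqP; rewrite mulmx_free_eq0 // row_mx_eq0.
have scalar0 c : c%:M == 0 :> 'M[K]_1 -> c = 0.
  by move/eqP/matrixP/(_ 0 0); rewrite !mxE eqxx.
by case/andP=> /scalar0-> /scalar0->.
Qed.

Lemma frame_neq0 u v a b : frame u v -> (a != 0) || (b != 0) -> a *: u + b *: v != 0.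
Proof.
move=> uv; apply: contraTneq => /(frame_free uv)[-> ->].
by rewrite eqxx.
Qed.

Lemma frame_inj u v a b a' b' : frame u v ->
  a *: u + b *: v = a' *: u + b' *: v -> a = a' /\ b = b'.
Proof.
move=> uv E; have := @frame_free u v (a - a') (b - b') uv.
have -> : (a - a') *: u + (b - b') *: v = 0.
  by rewrite !scalerBl addrACA -opprD E subrr.
by move/(_ erefl) => [/eqP + /eqP]; rewrite !subr_eq0 => /eqP-> /eqP->.
Qed.

Lemma frame_intro u v : (u <= g)%MS -> (v <= g)%MS ->
  (forall a b, a *: u + b *: v = 0 -> a = 0 /\ b = 0) -> frame u v.
Proof.
move=> ug vg free_uv; have [_ rg _ _] := hg.
rewrite /frame -mxrank_leqif_eq; last by rewrite col_mx_sub ug.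
rewrite rg; suff /eqP-> : row_free (col_mx u v) by [].
apply: inj_row_free => x; rewrite -[x]hsubmxK mul_row_col.
rewrite [lsubmx x]mx11_scalar [rsubmx x]mx11_scalar !mul_scalar_mx.
by case/free_uv=> -> ->; rewrite !raddf0 row_mx0.
Qed.

Lemma frame_complete u : (u <= g)%MS -> u != 0 -> exists v, frame u v.
Proof.
move=> ug u0; have [_ rg _ _] := hg.
have [] := boolP (g <= u)%MS; first by move/mxrankS; rewrite rg rank_rV u0.
case/row_subPn=> i nu; exists (row i g); apply: frame_intro; rewrite ?row_sub //.
move=> a b ab0; have b0 : b = 0.
  apply: contraNeq nu => b0; apply/sub_rVP; exists (- (b^-1 * a)).
  apply: (scalerI b0); rewrite scalerA mulrN mulVKf // scaleNr.
  by apply/eqP; rewrite -addr_eq0 addrC ab0.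
split=> //; move: ab0; rewrite b0 scale0r addr0 => /eqP.
by rewrite scaler_eq0 (negPf u0) orbF => /eqP.
Qed.

(** * Baer sublines and reguli *)

Section BaerRegulus.
Variables (u v : 'rV[K]_4) (b : {set 'M[K]_4}).
Hypothesis uv : frame u v.
Hypothesis hb : forall P, P \in b <->
  exists a c : K, [/\ Fq q a, Fq q c, (a, c) != (0, 0) & P = <<a *: u + c *: v>>%MS].

Definition baer_vector (w : 'rV[K]_4) := exists a c, [/\ f a = a, f c = c & w = a *: u + c *: v].

Lemma baer_vector_sub w : baer_vector w -> (w <= g)%MS.
Proof. by case=> a [c [_ _ ->]]; apply: frame_comb. Qed.

Lemma lines_of_baerP l : l \in lines_of S b <->
  exists w, [/\ baer_vector w, w != 0 & l = L w].
Proof.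
split=> [|[w [bw w0 ->]]].
  rewrite inE => /andP[lS /exists_inP[T /hb[a [c [Fa Fc ac ->]]]]].
  rewrite genmxE => wl; exists (a *: u + c *: v).
  have w0 : a *: u + c *: v != 0.
    apply: frame_neq0 => //; move: ac; rewrite -negb_and.
    by apply: contraNN => /andP[/eqP-> /eqP->].
  split=> //; first by exists a, c; split=> //; apply/eqP; rewrite -Fq_fix.
  apply: (spread_line_eq (y := 0)) => //; rewrite ?sub0mx ?frame_comb //.
  by rewrite map_mx0 addr0.
rewrite inE conj_span_spread ?baer_vector_sub //; apply/exists_inP.
have [a [c [fa fc wE]]] := bw.
exists <<w>>%MS; last first.
  by rewrite genmxE; apply/conj_spanP; exists 1, 0; rewrite scale1r scale0r addr0.
apply/hb; exists a, c; rewrite !Fq_fix fa fc !eqxx -wE; split=> //.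
by apply: contra_neq w0 => -[a0 c0]; rewrite wE a0 c0 !scale0r addr0.
Qed.

(** Cramer's rule over GF(q): if the determinant [D] vanished, w1 and w2 would be proportional and
    their spread lines equal. *)
Lemma baer_vector_span w1 w2 w : baer_vector w1 -> baer_vector w2 -> baer_vector w ->
  w1 != 0 -> w2 != 0 -> L w1 != L w2 ->
  exists s t, [/\ f s = s, f t = t & w = s *: w1 + t *: w2].
Proof.
move=> [a1 [c1 [fa1 fc1 w1E]]] [a2 [c2 [fa2 fc2 w2E]]] [a [c [fa fc wE]]] w10 w20 L12.
pose D := a1 * c2 - a2 * c1.
have D0 : D != 0.
  apply: contraNneq L12 => /eqP; rewrite subr_eq0 => /eqP DE.
  have prop k : w2 = k *: w1 -> L w1 == L w2.
    move=> w2k; rewrite w2k conj_spanZ //.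
    by apply: contraNneq w20 => k0; rewrite w2k k0 scale0r.
  have [a10|a10] := eqVneq a1 0; last first.
    apply: (prop (a2 / a1)); rewrite w1E w2E scalerDr !scalerA divfK //.
    by congr (_ + _ *: _); apply: (mulfI a10); rewrite DE; field.
  have [c10|c10] := eqVneq c1 0; first by case/eqP: w10; rewrite w1E a10 c10 !scale0r addr0.
  apply: (prop (c2 / c1)); rewrite w1E w2E scalerDr !scalerA divfK //.
  by congr (_ *: _ + _); apply: (mulfI c10); rewrite mulrC -DE; field.
exists ((a * c2 - a2 * c) / D), ((a1 * c - a * c1) / D).
split; try by rewrite fmorph_div !rmorphB !rmorphM fa fc fa1 fa2 fc1 fc2.
rewrite wE w1E w2E !scalerDr !scalerA addrACA -!scalerDl.
by congr (_ *: _ + _ *: _); rewrite /D; field.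
Qed.

Lemma meetP (U V : 'M[K]_4) :
  reflect (exists x : 'rV_4, [/\ x != 0, (x <= U)%MS & (x <= V)%MS]) (meet U V).
Proof.
rewrite /meet lt0n mxrank_eq0; apply: (iffP idP) => [UV0|[x [x0 xU xV]]].
  exists (nz_row (U :&: V)%MS); rewrite nz_row_eq0 UV0.
  by have := nz_row_sub (U :&: V)%MS; rewrite sub_capmx => /andP[-> ->].
apply: contraNneq x0 => UV0; have : (x <= U :&: V)%MS by rewrite sub_capmx xU.
by rewrite UV0 submx0.
Qed.

(** A common point has unique components in g and in its conjugate; one of them is nonzero, and it
    makes w1 and w2 proportional. *)
Lemma conj_span_meet w1 w2 : (w1 <= g)%MS -> (w2 <= g)%MS ->
  meet (L w1) (L w2) -> L w1 = L w2.
Proof.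
move=> w1g w2g /meetP[x [x0 /conj_spanP[a1 [c1 xE]]]]; rewrite {}xE in x0 *.
have -> : c1 *: conj w1 = conj (f c1 *: w1) by rewrite map_mxZ fK.
move/(conj_span_coef w2g) => /(_ (scalemx_sub _ w1g) (scalemx_sub _ w1g)) [a2 [c2 [Ea Ec]]].
have prop a k : a != 0 -> a *: w1 = k *: w2 -> w1 != 0 -> L w1 = L w2.
  move=> a0 E w10; rewrite -(conj_spanZ w1 a0) E conj_spanZ //.
  by apply: contraNneq w10 => k0; apply/eqP/(scalerI a0); rewrite E k0 scale0r scaler0.
have w10 : w1 != 0 by apply: contraNneq x0 => ->; rewrite map_mx0 !scaler0 addr0.
have [a10|a10] := eqVneq a1 0; last exact: prop Ea w10.
apply: prop Ec w10; rewrite fmorph_eq0; apply: contraNneq x0 => c10.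
by rewrite a10 c10 !scale0r addr0.
Qed.

(** The points of the Baer subline are <v> and the <u + c v> with c in GF(q), and distinct points
    lie on distinct spread lines. *)
Lemma card_lines_of_baer : #|K| = (q ^ 2)%N -> #|lines_of S b| = q.+1.
Proof.
move=> hK; have [ug vg] := frame_sub uv.
have -> : lines_of S b = L v |: [set L (u + c *: v) | c in [pred x | Fq q x]].
  apply/setP=> l; apply/idP/idP => [/lines_of_baerP[w [[a [c [fa fc wE]]] w0 ->]]|].
    have [a0|a0] := eqVneq a 0.
      apply/setU1P; left; rewrite wE a0 scale0r add0r conj_spanZ //.
      by apply: contraNneq w0 => c0; rewrite wE a0 c0 !scale0r addr0.
    apply/setU1P; right; apply/imsetP; exists (c / a).
      by rewrite inE Fq_fix fmorph_div fa fc.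
    by rewrite -(conj_spanZ (u + _) a0) wE scalerDr scalerA [a * _]mulrC divfK.
  have frm a c : (a != 0) || (c != 0) -> a *: u + c *: v != 0 by apply: frame_neq0.
  case/setU1P=> [->|/imsetP[c + ->]].
    apply/lines_of_baerP; exists v; split=> //; last first.
      by have := frm 0 1; rewrite oner_eq0 orbT scale0r scale1r add0r => /(_ isT).
    by exists 0, 1; rewrite rmorph0 rmorph1 scale0r scale1r add0r.
  rewrite inE Fq_fix => /eqP fc; apply/lines_of_baerP; exists (u + c *: v); split=> //.
    by exists 1, c; rewrite rmorph1 scale1r.
  by have := frm 1 c; rewrite oner_eq0 scale1r => /(_ isT).
have eqL a c a' c' : a != 0 -> L (a *: u + c *: v) = L (a' *: u + c' *: v) ->
    exists k, a *: u + c *: v = k *: (a' *: u + c' *: v).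
  move=> a0 E; have : ((a *: u + c *: v)%R <= L (a' *: u + c' *: v)%R)%MS.
    by rewrite -E; apply/conj_spanP; exists 1, 0; rewrite scale1r scale0r addr0.
  move=> H; have := @conj_span_coef (a' *: u + c' *: v) (a *: u + c *: v) 0.
  rewrite map_mx0 addr0 !frame_comb // sub0mx => /(_ isT isT isT H)[k [_ [-> _]]].
  by exists k.
rewrite cardsU1 card_in_imset ?card_Fq //; last first.
  move=> c c' _ _; rewrite -{1 2}(scale1r u) => /eqL; rewrite oner_eq0 => /(_ isT)[k].
  rewrite scalerDr !scalerA => /(frame_inj uv)[]; rewrite mulr1 => <-.
  by rewrite mul1r.
case: imsetP => // -[c _]; rewrite -[v in LHS]scale1r -[X in L X]add0r -{1}(scale0r u).
rewrite -{2}(scale1r u) => /esym/eqL; rewrite oner_eq0 => /(_ isT)[k].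
rewrite scalerDr !scalerA => /(frame_inj uv)[/eqP]; rewrite mulr0 oner_eq0.
by [].
Qed.

(* With [p_i = x_i (x) w_i] in the tensor product [<u, conj u> (x) g], collinearity of
   the three points forces the [x_i] to be proportional, so that the transversal is
   [x (x) g]. *)
Lemma regulus_lines_of_baer : #|K| = (q ^ 2)%N -> regulus q (lines_of S b).
Proof.
move=> hK; split; first exact: card_lines_of_baer.
have real_l l : l \in lines_of S b -> realline q l.
  by rewrite inE => /andP[lS _]; have [+ _] := hS; apply.
split=> //; split=> [l m|m rm l1 l2 l3].
  move=> /lines_of_baerP[w1 [bw1 w10 ->]] /lines_of_baerP[w2 [bw2 w20 ->]].
  apply: contraNN => meet12; apply/eqP.
  by apply: conj_span_meet; rewrite ?baer_vector_sub.
move=> /lines_of_baerP[w1 [bw1 w10 ->]] /lines_of_baerP[w2 [bw2 w20 ->]].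
move=> /lines_of_baerP[w3 [bw3 w30 ->]] l12 l13 l23.
move=> /meetP[p1 [p10 p1m p1l]] /meetP[p2 [p20 p2m p2l]] /meetP[p3 [p30 p3m p3l]].
move=> l /lines_of_baerP[w [bw w0 ->]].
have p12 : (m == p1 + p2)%MS.
  rewrite andbC -mxrank_leqif_eq; last by rewrite addsmx_sub p1m.
  have /andP[_ /eqP->] := rm; rewrite eq_sym eqn_leq.
  have := mxrankS (_ : (p1 + p2 <= m)%MS); rewrite addsmx_sub p1m p2m => /(_ isT).
  have /andP[_ /eqP->] := rm => -> /=.
  have := mxrank_sum_cap p1 p2; rewrite !rank_rV p10 p20.
  suff -> : \rank (p1 :&: p2)%MS = 0%N by rewrite addn0 => ->.
  apply/eqP; rewrite mxrank_eq0; apply: contraNT l12 => cap0.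
  apply/eqP/conj_span_meet; rewrite ?baer_vector_sub //; apply/meetP.
  exists (nz_row (p1 :&: p2)%MS); rewrite nz_row_eq0 cap0.
  have := nz_row_sub (p1 :&: p2)%MS; rewrite sub_capmx => /andP[s1 s2].
  by rewrite (submx_trans s1) // (submx_trans s2).
have /sub_rV2P[s [t p3E]] : (p3 <= p1 + p2)%MS by rewrite -(eqmxP p12).
have [a1 [c1 p1E]] := conj_spanP _ _ p1l.
have [a2 [c2 p2E]] := conj_spanP _ _ p2l.
have [a3 [c3 p3E']] := conj_spanP _ _ p3l.
have [s3 [t3 [fs3 ft3 w3E]]] := baer_vector_span bw1 bw2 bw3 w10 w20 l12.
have [s4 [t4 [fs4 ft4 wE]]] := baer_vector_span bw1 bw2 bw w10 w20 l12.
have s30 : s3 != 0.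
  apply: contraNneq l23 => s30; rewrite w3E s30 scale0r add0r conj_spanZ //.
  by apply: contraNneq w30 => t30; rewrite w3E s30 t30 !scale0r addr0.
have t30 : t3 != 0.
  by apply: contraNneq l13 => t30; rewrite w3E t30 scale0r addr0 conj_spanZ.
have w1g := baer_vector_sub bw1; have w2g := baer_vector_sub bw2.
have w12 : frame w1 w2.
  apply: frame_intro => // a c ac0.
  have a0 : a = 0.
    apply: contraNeq l12 => a0; have w1E : w1 = - (c / a) *: w2.
      apply: (scalerI a0); rewrite scalerA mulrN mulrC divfK // scaleNr.
      by apply/eqP; rewrite -addr_eq0 ac0.
    by rewrite w1E conj_spanZ //; apply: contraNneq w10 => k0; rewrite w1E k0 scale0r.
  split=> //; move/eqP: ac0; rewrite a0 scale0r add0r scaler_eq0 (negPf w20) orbF.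
  by move/eqP.
(* Comparing the components of p3 = s p1 + t p2 along w1, w2 and their conjugates gives s p1 = s3
   (a3 w1 + c3 w1') and t p2 = t3 (a3 w2 + c3 w2'). *)
have := @transversal_inj (a3 *: w3) (f c3 *: w3) ((s * a1) *: w1 + (t * a2) *: w2)
  (f (s * c1) *: w1 + f (t * c2) *: w2).
rewrite !frame_comb // !scalemx_sub ?baer_vector_sub // => /(_ isT isT isT isT).
rewrite map_mxD !map_mxZ !fK -p3E' p3E p1E p2E !scalerDr !scalerA => /(_ (addrACA _ _ _ _)).
rewrite w3E !scalerDr !scalerA => -[/(frame_inj w12)[Ea1 Ea2] /(frame_inj w12)[Ec1 Ec2]].
have {}Ec1 : c3 * s3 = s * c1 by apply: (can_inj fK); rewrite rmorphM fs3.
have {}Ec2 : c3 * t3 = t * c2 by apply: (can_inj fK); rewrite rmorphM ft3.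
(* As w = s4 w1 + t4 w2, this point is (s4 / s3) s p1 + (t4 / t3) t p2, which lies on m. *)
apply/meetP; exists (a3 *: w + c3 *: conj w); split; last by apply/conj_spanP; exists a3, c3.
  apply: contraNneq p30; have -> : c3 *: conj w = conj (f c3 *: w) by rewrite map_mxZ fK.
  have wg := baer_vector_sub bw.
  case/transversal_direct; rewrite ?scalemx_sub // => /eqP + /eqP.
  rewrite !scaler_eq0 (negPf w0) !orbF fmorph_eq0 p3E' => /eqP-> /eqP->.
  by rewrite !scale0r addr0.
rewrite (eqmxP p12); apply/sub_rV2P; exists (s4 / s3 * s), (t4 / t3 * t).
rewrite p1E p2E wE map_mxD !map_mxZ fs4 ft4 !scalerDr !scalerA addrACA.
congr (_ *: _ + _ *: _ + (_ *: _ + _ *: _)).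
- by rewrite -[RHS]mulrA -Ea1; field.
- by rewrite -[RHS]mulrA -Ec1; field.
- by rewrite -[RHS]mulrA -Ea2; field.
- by rewrite -[RHS]mulrA -Ec2; field.
Qed.
End BaerRegulus.
(** * Conics in a real plane *)

Section Plane.
Variables (B : 'M[K]_(3, 4)) (A : 'M[K]_3).
Hypotheses (hK : #|K| = (q ^ 2)%N) (hB : nondeg_conic q B A).

Let rB : conj B = B. Proof. by apply/realmxP; case: hB. Qed.
Let rA : conj A = A. Proof. by apply/realmxP; case: hB. Qed.
Let freeB : row_free B. Proof. by rewrite /row_free; case: hB => _ ->. Qed.

Lemma transversal_full : row_full (g + conj g)%MS.
Proof.
have [_ rg _ _] := hg; rewrite /row_full.
have := mxrank_sum_cap g (conj g); rewrite mxrank_map rg.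
suff /eqP-> : \rank (g :&: conj g)%MS == 0%N by rewrite addn0 => ->.
rewrite mxrank_eq0; apply/rowV0P => x; rewrite sub_capmx => /andP[xg xcg].
by apply: transversal_disjoint; rewrite // -[g]map_mx_invol map_submx.
Qed.

Lemma transversal_decomp (w : 'rV[K]_4) :
  exists x z, [/\ (x <= g)%MS, (z <= g)%MS & w = x + conj z].
Proof.
have /sub_addsmxP[[a c] /= ->] := submx_full w transversal_full.
exists (a *m g), (conj c *m g); rewrite !submxMl; split=> //.
by rewrite map_mxM map_mx_invol.
Qed.

(** A real plane containing g contains its conjugate, and the two span the whole space. *)
Lemma transversal_notin_plane : ~~ (g <= B)%MS.
Proof.
apply/negP => gB; have : (g + conj g <= B)%MS by rewrite addsmx_sub gB real_subc.
move/mxrankS; rewrite (eqP transversal_full).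
by case: hB => _ ->.
Qed.

Lemma plane_meets_transversal : exists2 u : 'rV[K]_4, u != 0 & (u <= g)%MS && (u <= B)%MS.
Proof.
have [_ rg _ _] := hg; have := mxrank_sum_cap g B; rewrite rg (eqP freeB) => rk.
have le4 : (\rank (g + B)%MS <= 4)%N := rank_leq_col _.
have cap0 : (g :&: B)%MS != 0.
  by rewrite -mxrank_eq0; apply: contraTneq le4 => cap0; move: rk; rewrite cap0 addn0 => ->.
by exists (nz_row (g :&: B)%MS); rewrite ?nz_row_eq0 // -sub_capmx nz_row_sub.
Qed.

Lemma plane_frame_notin u v : frame u v -> (u <= B)%MS -> ~~ (v <= B)%MS.
Proof.
move=> uv uB; apply: contra transversal_notin_plane => vB.
by rewrite -(eqmxP uv) col_mx_sub uB.
Qed.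

Lemma plane_transversal_unique (u x : 'rV[K]_4) : u != 0 -> (u <= g)%MS -> (u <= B)%MS ->
  (x <= g)%MS -> (x <= B)%MS -> exists k, x = k *: u.
Proof.
move=> u0 ug uB xg xB; have [v uv] := frame_complete ug u0.
have [a [b xE]] := frameP _ uv xg; exists a.
have [b0|b0] := eqVneq b 0; first by rewrite xE b0 scale0r addr0.
have := plane_frame_notin uv uB.
suff -> : (v <= B)%MS by [].
have -> : v = b^-1 *: (x - a *: u) by rewrite xE addrC addKr scalerA mulVf ?scale1r.
by rewrite scalemx_sub // addmx_sub // -scaleN1r !scalemx_sub.
Qed.

(** Some row of [B] lies outside <u, u'>. Being real, it is w + w' with w = a u + t v, and removing
    a u + a' u' leaves t v + t' v'. *)
Lemma plane_third_point u v : frame u v -> (u <= B)%MS ->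
  exists2 t, t != 0 & ((t *: v + conj (t *: v))%R <= B)%MS.
Proof.
move=> uv uB; have cuB : (conj u <= B)%MS by rewrite real_subc.
have : ~~ (B <= u + conj u)%MS.
  apply/negP => /mxrankS; rewrite (eqP freeB) => le3.
  have := leq_trans le3 (mxrank_adds_leqif u (conj u)).
  by rewrite !rank_rV; do 2![case: (_ != 0)].
case/row_subPn=> i; set R := row i B => nR.
have rR : conj R = R by rewrite /R map_row rB.
have [x [z [xg zg RE]]] := transversal_decomp R.
have xz : x = z.
  apply: (proj1 (transversal_inj xg zg zg xg _)).
  by rewrite -RE -{1}rR RE map_mxD map_mx_invol addrC.
have [a [t xE]] := frameP _ uv xg; exists t.
  apply: contraNneq nR => t0; rewrite RE -xz xE t0 scale0r addr0 map_mxZ.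
  by apply/sub_rV2P; exists a, (f a).
have -> : t *: v + conj (t *: v) = R - (a *: u + f a *: conj u).
  by rewrite RE -xz xE map_mxD !map_mxZ; apply/rowP=> j; rewrite !mxE; ring.
by rewrite addmx_sub ?row_sub // -scaleN1r scalemx_sub // addmx_sub ?scalemx_sub.
Qed.

Section Coordinates.
Variables u v : 'rV[K]_4.
Hypotheses (uv : frame u v) (uB : (u <= B)%MS) (vB : ((v + conj v)%R <= B)%MS).

(** Here w = x + x' with x = a u + r v. If r were not fixed, subtracting a u + a' u' + r (v + v')
    would put v', and then v, in the plane. *)
Lemma plane_real_coords (w : 'rV[K]_4) : (w <= B)%MS -> conj w = w ->
  exists a r, f r = r /\ w = (a *: u + r *: v) + conj (a *: u + r *: v).
Proof.
move=> wB rw; have [x [z [xg zg wE]]] := transversal_decomp w.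
have xz : x = z.
  apply: (proj1 (transversal_inj xg zg zg xg _)).
  by rewrite -wE -{1}rw wE map_mxD map_mx_invol addrC.
have [a [r xE]] := frameP _ uv xg; exists a, r; split; last by rewrite wE -xz xE.
apply/eqP; apply: contraNT (plane_frame_notin uv uB) => fr.
have dr : f r - r != 0 by rewrite subr_eq0.
rewrite -(real_subc _ rB).
have -> : conj v = (f r - r)^-1 *: (w - (a *: u + f a *: conj u + r *: (v + conj v))).
  apply: (scalerI dr); rewrite scalerA divff // scale1r wE -xz xE map_mxD !map_mxZ.
  by apply/rowP=> i; rewrite !mxE; ring.
rewrite scalemx_sub // addmx_sub // -scaleN1r scalemx_sub // !addmx_sub ?scalemx_sub //.
by rewrite real_subc.
Qed.
End Coordinates.

(** * The quadratic form of the conic and its polar form *)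

Definition polar (y z : 'rV[K]_3) : K := (y *m (A + A^T) *m z^T) 0 0.

Lemma polarDl x y z : polar (x + y) z = polar x z + polar y z.
Proof. by rewrite /polar !mulmxDl mxE. Qed.

Lemma polarZl a y z : polar (a *: y) z = a * polar y z.
Proof. by rewrite /polar -!scalemxAl mxE. Qed.

Let trmx00 (M : 'M[K]_1) : M^T 0 0 = M 0 0. Proof. by rewrite mxE. Qed.

Lemma polarC y z : polar y z = polar z y.
Proof.
by rewrite /polar -[LHS]trmx00 !trmx_mul trmxK linearD /= trmxK [A^T + A]addrC mulmxA.
Qed.

Lemma polarDr x y z : polar x (y + z) = polar x y + polar x z.
Proof. by rewrite !(polarC x) polarDl. Qed.

Lemma polarZr a y z : polar y (a *: z) = a * polar y z.
Proof. by rewrite !(polarC y) polarZl. Qed.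

Lemma qfZ a y : qf A (a *: y) = a ^+ 2 * qf A y.
Proof. by rewrite /qf linearZ /= -scalemxAr -!scalemxAl !mxE mulrA. Qed.

Lemma qfD y z : qf A (y + z) = qf A y + qf A z + polar y z.
Proof.
have E : polar y z = (y *m A *m z^T) 0 0 + (z *m A *m y^T) 0 0.
  rewrite /polar mulmxDr mulmxDl mxE; congr (_ + _).
  by rewrite -[LHS]trmx00 !trmx_mul !trmxK mulmxA.
by rewrite E /qf linearD /= mulmxDr !mulmxDl !mxE; ring.
Qed.

Lemma polar_diag y : polar y y = qf A y + qf A y.
Proof.
by apply: (addrI (qf A y + qf A y)); rewrite -qfD -[in LHS](scale1r y) -scalerDl qfZ; ring.
Qed.

Lemma qf_conj y : qf A (conj y) = f (qf A y).
Proof. by rewrite /qf -[in LHS]rA map_trmx -!map_mxM mxE. Qed.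

Lemma polar_conj y z : polar (conj y) (conj z) = f (polar y z).
Proof. by rewrite /polar -[in LHS]rA !map_trmx -map_mxD -!map_mxM mxE. Qed.

(** It is enough to test the polar form on real vectors, since the unit vectors are real. *)
Lemma nonsingular y : conj y = y -> y != 0 -> qf A y = 0 ->
  (forall z, conj z = z -> polar y z = 0) -> False.
Proof.
move=> ry y0 qy py; have [_ _ _ /(_ y)] := hB.
case/(_ (introT (realmxP _) ry) y0 qy)/eqP; apply/rowP=> i.
have := py (delta_mx 0 i); rewrite /polar trmx_delta -colE !mxE; apply.
by rewrite map_delta_mx.
Qed.
Section ConicCoordinates.
Variables (u v : 'rV[K]_4) (yu yR : 'rV[K]_3).
Hypotheses (uv : frame u v) (yuB : yu *m B = u) (yRB : yR *m B = v + conj v).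

(** [yu] and [yR] are the coordinates of u and v + v' in the plane [B]; for r in GF(q) the formula
    then runs through the coordinates of the real vectors of the plane. *)
Definition plane_vec (a r : K) := a *: yu + f a *: conj yu + r *: yR.

Let ryR : conj yR = yR.
Proof.
apply: (row_free_inj freeB); rewrite -[in LHS]rB -map_mxM yRB map_mxD map_mx_invol.
by rewrite addrC.
Qed.

Let uB : (u <= B)%MS. Proof. by rewrite -yuB submxMl. Qed.
Let vB : ((v + conj v)%R <= B)%MS. Proof. by rewrite -yRB submxMl. Qed.

Lemma plane_vecM a r : f r = r ->
  plane_vec a r *m B = (a *: u + r *: v) + conj (a *: u + r *: v).
Proof.
move=> fr; rewrite !mulmxDl -!scalemxAl yRB -[in conj yu *m B]rB -map_mxM yuB.
by rewrite map_mxD !map_mxZ fr; apply/rowP=> i; rewrite !mxE; ring.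
Qed.

Lemma plane_vec_real a r : f r = r -> conj (plane_vec a r) = plane_vec a r.
Proof.
move=> fr; rewrite !map_mxD !map_mxZ map_mx_invol fK fr ryR; congr (_ + _).
by rewrite addrC.
Qed.

Lemma plane_vecP y : conj y = y -> exists a r, f r = r /\ y = plane_vec a r.
Proof.
move=> ry; have := plane_real_coords uv uB vB (submxMl y B).
rewrite map_mxM ry rB => /(_ erefl)[a [r [fr E]]]; exists a, r; split=> //.
by apply: (row_free_inj freeB); rewrite plane_vecM.
Qed.

Lemma plane_vec_eq0 a r : f r = r -> plane_vec a r = 0 -> a = 0 /\ r = 0.
Proof.
move=> fr y0; have : plane_vec a r *m B = 0 by rewrite y0 mul0mx.
rewrite plane_vecM // => /(transversal_direct (frame_comb _ _ uv) (frame_comb _ _ uv))[].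
by move/(frame_free uv).
Qed.

Let e := qf A yu.
Let k := polar yu (conj yu).
Let m := polar yu yR.
Let n := qf A yR.

Lemma polar_conj_fix : f k = k.
Proof. by rewrite -polar_conj map_mx_invol polarC. Qed.

Lemma qf_real_fix : f n = n.
Proof. by rewrite -qf_conj ryR. Qed.

Let cuR : polar (conj yu) yR = f m. Proof. by rewrite -polar_conj ryR. Qed.

Lemma qf_plane_vec a r : qf A (plane_vec a r) =
  e * a ^+ 2 + f e * f a ^+ 2 + k * (a * f a) + r * (m * a + f m * f a) + n * r ^+ 2.
Proof.
rewrite /plane_vec !qfD !qfZ qf_conj !(polarDl, polarZl, polarZr) cuR.
rewrite -/e -/n -/k -/m; ring.
Qed.

Lemma polar_plane_vec a r b s : polar (plane_vec a r) (plane_vec b s) =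
  (e + e) * (a * b) + (f e + f e) * (f a * f b) + k * (a * f b + f a * b)
  + s * (m * a + f m * f a) + r * (m * b + f m * f b) + (n + n) * (r * s).
Proof.
rewrite /plane_vec !(polarDl, polarDr, polarZl, polarZr) cuR !(polarC yR) cuR.
rewrite !polar_diag qf_conj (polarC (conj yu) yu) -/e -/n -/k -/m; ring.
Qed.

(* [a * f a = r ^+ 2] is the trace on the plane of the quadric carrying the regulus
   of the Baer subline of the points [<f z *: u + z *: v>]. *)
Lemma conic_on_circle :
  (forall a r, f r = r -> plane_vec a r != 0 -> qf A (plane_vec a r) = 0 ->
     a * f a = r ^+ 2) ->
  qf A (plane_vec 1 1) = 0 -> qf A yu = 0.
Proof.
move=> zeros; rewrite qf_plane_vec => Q11.
apply: (circle_form_coef0 fK fth polar_conj_fix qf_real_fix _ Q11) => [a r fr ar0 Q0|].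
  apply: zeros; rewrite ?qf_plane_vec //.
  by apply: contraTneq ar0 => /(plane_vec_eq0 fr)[-> ->]; rewrite eqxx.
(* With c = e + e + k + m, the polar form of (1, 1) and (a, r) is c a + c' a' + r (2 Q(1, 1) - c -
   c'), so c = 0 would make (1, 1) singular. *)
apply/eqP=> c0; have f1 := rmorph1 f.
apply: (nonsingular (plane_vec_real 1 f1)).
- by apply/eqP => /(plane_vec_eq0 f1)[/eqP]; rewrite oner_eq0.
- by rewrite qf_plane_vec.
move=> z /plane_vecP[a [r [fr ->]]]; rewrite polar_plane_vec.
have fc0 : f e + f e + k + f m = 0.
  by rewrite -[X in _ + X + _]polar_conj_fix -!rmorphD c0 rmorph0.
transitivity ((e + e + k + m) * a + (f e + f e + k + f m) * f a
  + r * ((1 + 1) * (e * 1 ^+ 2 + f e * f 1 ^+ 2 + k * (1 * f 1)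
      + 1 * (m * 1 + f m * f 1) + n * 1 ^+ 2)
    - (e + e + k + m) - (f e + f e + k + f m))).
  by rewrite f1; ring.
by rewrite Q11 c0 fc0 !mul0r mulr0 !subr0 mulr0 !addr0.
Qed.
End ConicCoordinates.

(** * Special conics and their reguli *)

Lemma rank1_conj_sub (x : 'rV[K]_4) : (x <= conj g)%MS = (conj x <= g)%MS.
Proof. by rewrite -{1}(map_mx_invol x) map_submx. Qed.

(** Uniqueness holds because the plane meets g only in <u>; the conic being real, conjugation gives
    the point on the other transversal. *)
Lemma g_special_intro u yu : u != 0 -> (u <= g)%MS -> yu *m B = u ->
  qf A yu = 0 -> g_special q g B A.
Proof.
move=> u0 ug yuB q0; have uB : (u <= B)%MS by rewrite -yuB submxMl.
have yu0 : yu != 0 by apply: contraNneq u0 => yu0; rewrite -yuB yu0 mul0mx.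
have genmx_prop (x w : 'rV[K]_4) c : x != 0 -> x = c *: w -> <<w>>%MS = <<x>>%MS.
  move=> x0 xE; apply/esym; rewrite xE; apply: eq_genmx; apply: eqmx_scale.
  by apply: contraNneq x0 => c0; rewrite xE c0 scale0r.
split; [exists <<u>>%MS | exists <<conj u>>%MS]; split.
- split; [exact: pt_genmx | by rewrite genmxE | apply/existsP; exists yu].
  by rewrite yu0 q0 yuB !eqxx.
- move=> T [_ Tg /existsP[y /and3P[y0 _ /eqP TE]]]; rewrite TE genmxE in Tg *.
  have yB0 : y *m B != 0 by rewrite mulmx_free_eq0.
  have [c yE] := plane_transversal_unique u0 ug uB Tg (submxMl _ _).
  exact: genmx_prop yE.
- split; first by apply: pt_genmx; rewrite map_mx_eq0.
    by rewrite conjspE !genmxE map_submx.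
  apply/existsP; exists (conj yu).
  by rewrite map_mx_eq0 yu0 qf_conj q0 rmorph0 -[in conj yu *m B]rB -map_mxM yuB !eqxx.
- move=> T [_ + /existsP[y /and3P[y0 _ /eqP TE]]]; rewrite conjspE TE !genmxE rank1_conj_sub => Tg.
  have yB0 : y *m B != 0 by rewrite mulmx_free_eq0.
  have [|c yE] := plane_transversal_unique u0 ug uB Tg.
    by rewrite map_mxM rB submxMl.
  apply: (genmx_prop _ _ (f c) yB0).
  by rewrite -[LHS]map_mx_invol yE map_mxZ.
Qed.

Lemma baer_conic_special b : baer_subline q g b ->
  (forall l, l \in lines_of S b -> ~~ (l <= B)%MS) ->
  conic_in q B A (lines_of S b) -> g_special q g B A.
Proof.
move=> [ub [vb [/= uvb hb]]] noline conicb.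
have [u0 u00 /andP[u0g u0B]] := plane_meets_transversal.
(* If the point of g in the plane were on the Baer subline, its whole spread line <w, w'> would be
   in the plane. *)
have not_baer w c : baer_vector ub vb w -> u0 = c *: w -> False.
  move=> bw u0E; have c0 : c != 0 by apply: contraNneq u00 => c0; rewrite u0E c0 scale0r.
  have w0 : w != 0 by apply: contraNneq u00 => w0; rewrite u0E w0 scaler0.
  have := noline (L w); rewrite (proj2 (lines_of_baerP uvb hb _)); last by exists w.
  move/(_ isT)/negP; apply.
  have wB : (w <= B)%MS by rewrite -(eqmx_scale w c0) -u0E.
  by rewrite genmxE addsmx_sub wB real_subc.
have [G [F u0E]] := frameP _ uvb u0g.
have F0 : F != 0.
  apply/eqP=> F0; apply: (not_baer ub G); last by rewrite u0E F0 scale0r addr0.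
  by exists 1, 0; rewrite rmorph0 rmorph1 scale1r scale0r addr0.
pose t := - (G / F); have u0t : u0 = F *: (vb - t *: ub).
  by rewrite u0E scalerBr scalerA /t mulrN mulrC divfK // scaleNr opprK addrC.
clearbody t; have ft : f t != t.
  apply/eqP=> ft; apply: (not_baer _ _ _ u0t).
  exists (- t), 1; rewrite rmorphN rmorph1 ft scale1r scaleNr; split=> //.
  by rewrite addrC.
have dt0 : f t - t != 0 by rewrite subr_eq0.
(* In the basis u1, v1 the Baer vector s ub + s' vb is z' u1 + z v1 with z = s + s' t, while <u1> is
   still the point of g in the plane. *)
pose u1 := (f t - t)^-1 *: (vb - t *: ub).
pose v1 := (t - f t)^-1 *: (vb - f t *: ub).
have dt0' : t - f t != 0 by rewrite -opprB oppr_eq0.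
have ubE : ub = u1 + v1 by apply/rowP=> i; rewrite !mxE; field; rewrite dt0 dt0'.
have vbE : vb = f t *: u1 + t *: v1 by apply/rowP=> i; rewrite !mxE; field; rewrite dt0 dt0'.
have u1g : (u1 <= g)%MS.
  have -> : u1 = ((f t - t)^-1 * - t) *: ub + (f t - t)^-1 *: vb.
    by rewrite /u1; apply/rowP=> i; rewrite !mxE; ring.
  exact: frame_comb.
have v1g : (v1 <= g)%MS.
  have -> : v1 = ((t - f t)^-1 * - f t) *: ub + (t - f t)^-1 *: vb.
    by rewrite /v1; apply/rowP=> i; rewrite !mxE; ring.
  exact: frame_comb.
have uv1 : frame u1 v1.
  rewrite /frame col_mx_sub u1g v1g /= -(eqmxP uvb) col_mx_sub.
  by rewrite -!addsmxE; apply/andP; split; apply/sub_rV2P;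
    [exists 1, 1; rewrite !scale1r | exists (f t), t].
have u1B : (u1 <= B)%MS by apply: scalemx_sub; rewrite -(eqmx_scale _ F0) -u0t.
clearbody u1 v1.
have [tau tau0 tauB] := plane_third_point uv1 u1B.
(* On the regulus, [a * f tau] and [r * tau] are [l * f z] and [l * z] for some [l]. *)
have zeros a r : f r = r -> (a != 0) || (r != 0) -> forall y, conj y = y -> qf A y = 0 ->
    y *m B = (a *: (f tau *: u1) + r *: (tau *: v1))
      + conj (a *: (f tau *: u1) + r *: (tau *: v1)) ->
    a * f a = r ^+ 2.
  move=> fr ar0 y ry qy yB.
  have xg : ((a *: (f tau *: u1) + r *: (tau *: v1))%R <= g)%MS.
    by rewrite !scalerA frame_comb.
  have y0 : y != 0.
    apply: contraTneq ar0 => y0; move: yB; rewrite y0 mul0mx => /esym.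
    case/(transversal_direct xg xg) => + _.
    rewrite !scalerA => /(frame_free uv1)[/eqP + /eqP].
    by rewrite !mulf_eq0 fmorph_eq0 (negPf tau0) !orbF => /eqP-> /eqP->; rewrite eqxx.
  have [|l lb Pl] := conicb <<y *m B>>%MS.
    by apply/existsP; exists y; rewrite (introT (realmxP _) ry) y0 qy !eqxx.
  have [w [bw w0 lE]] := proj1 (lines_of_baerP uvb hb _) lb.
  have wg := baer_vector_sub uvb bw.
  rewrite genmxE yB lE in Pl; have [c [_ [+ _]]] := conj_span_coef wg xg xg Pl.
  have [s [s' [fs fs' ->]]] := bw.
  have -> : c *: (s *: ub + s' *: vb) =
      (c * (s + s' * f t)) *: u1 + (c * (s + s' * t)) *: v1.
    by rewrite ubE vbE; apply/rowP=> i; rewrite !mxE; ring.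
  rewrite !scalerA => /(frame_inj uv1)[Ea Er].
  have N0 : tau * f tau != 0 by rewrite mulf_neq0 ?fmorph_eq0.
  apply: (mulfI N0); transitivity (a * f tau * f (a * f tau)).
    by rewrite rmorphM fK; ring.
  rewrite Ea; transitivity (r * tau * f (r * tau)); last by rewrite rmorphM fr; ring.
  by rewrite Er !rmorphM !rmorphD !rmorphM fK fs fs'; ring.
(* The factor [tau] puts the real point of v1 in the plane; [f tau] has the same norm, which is why
   no constant remains in a a' = r^2. *)
have uv2 : frame (f tau *: u1) (tau *: v1).
  apply: frame_intro; rewrite ?scalemx_sub // => a c.
  rewrite !scalerA => /(frame_free uv1)[/eqP + /eqP].
  by rewrite !mulf_eq0 fmorph_eq0 (negPf tau0) !orbF => /eqP-> /eqP->.
have u2B : (f tau *: u1 <= B)%MS by rewrite scalemx_sub.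
have [yu yuB] := submxP u2B; have [yR yRB] := submxP tauB.
(* At a rational point of the conic a a' = r^2, so a / r has norm 1. Scaling u by it preserves the
   equation a a' = r^2 and moves the point to (1, 1), as [conic_on_circle] requires. *)
have [y [/realmxP ry y0 qy]] : exists y, [/\ Defs.realmx q y, y != 0 & qf A y = 0].
  by apply: ternary_form_isotropic; case: hB.
have [a [r [fr yE]]] := plane_vecP uv2 (esym yuB) (esym yRB) ry.
have vecM := plane_vecM (v := tau *: v1) (esym yuB) (esym yRB).
have ar0 : (a != 0) || (r != 0).
  rewrite -negb_and; apply: contraNN y0 => /andP[/eqP a0 /eqP r0].
  by rewrite yE a0 r0 /plane_vec rmorph0 !scale0r !addr0.
have Na : a * f a = r ^+ 2.
  by apply: (zeros _ _ fr ar0 y) => //; rewrite yE vecM.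
have r0 : r != 0.
  apply: contraTneq ar0 => r0; move/eqP: Na; rewrite r0 expr0n /= mulf_eq0 fmorph_eq0 orbb.
  by move=> /eqP->; rewrite eqxx.
have a0 : a != 0.
  by apply: contraNneq r0 => a0; move: Na; rewrite a0 mul0r => /esym/eqP; rewrite expf_eq0.
pose c := a / r; have c0 : c != 0 by rewrite mulf_neq0 ?invr_eq0.
have Nc : c * f c = 1 by rewrite /c fmorph_div fr mulrACA Na -invfM divff // expf_neq0.
have yuB3 : (c *: yu) *m B = c *: (f tau *: u1) by rewrite -scalemxAl -yuB.
have uv3 : frame (c *: (f tau *: u1)) (tau *: v1).
  apply: frame_intro; rewrite ?scalemx_sub // => x z.
  rewrite [x *: _]scalerA => /(frame_free uv2)[/eqP + ->].
  by rewrite mulf_eq0 (negPf c0) orbF => /eqP->.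
apply: (g_special_intro _ _ yuB3); rewrite ?scalemx_sub //.
  by have := frame_neq0 (a := 1) (b := 0) uv3; rewrite oner_eq0 scale1r scale0r addr0 => /(_ isT).
have vecE x s : plane_vec (c *: yu) yR x s = plane_vec yu yR (x * c) s.
  by rewrite /plane_vec map_mxZ !scalerA rmorphM.
apply: (conic_on_circle uv3 yuB3 (esym yRB)) => [x s fs y1 q1|].
  rewrite vecE in y1 q1; transitivity ((x * c) * f (x * c)).
    by rewrite rmorphM mulrACA Nc mulr1.
  apply: (zeros _ _ fs _ _ _ q1); last exact: vecM.
    rewrite -negb_and; apply: contraNN y1 => /andP[/eqP-> /eqP->].
    by rewrite /plane_vec rmorph0 !scale0r !addr0.
  exact: plane_vec_real (esym yRB) _ _ fs.
have -> : plane_vec (c *: yu) yR 1 1 = r^-1 *: y.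
  rewrite vecE yE /plane_vec mul1r !scalerDr !scalerA mulVf // /c fmorph_div fr.
  by rewrite [a / r]mulrC [f a / r]mulrC.
by rewrite qfZ qy mulr0.
Qed.
Lemma special_conic_circle : g_special q g B A -> exists u v yu yR,
  [/\ frame u v, yu *m B = u, yR *m B = v + conj v &
   forall a r, f r = r -> qf A (plane_vec yu yR a r) = 0 <-> a * f a = r ^+ 2].
Proof.
case=> [[T [[_ Tg /existsP[yu /and3P[yu0 /eqP e0 /eqP TE]]] _]] _].
move: Tg; rewrite TE genmxE => ug; set u := yu *m B in ug.
have u0 : u != 0 by rewrite mulmx_free_eq0.
have uB : (u <= B)%MS := submxMl _ _.
have [v1 uv1] := frame_complete ug u0.
have [t t0 /submxP[yR1 /esym yR1B]] := plane_third_point uv1 uB.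
have uv2 : frame u (t *: v1).
  have [_ v1g] := frame_sub uv1.
  apply: frame_intro; rewrite ?scalemx_sub // => a c.
  by rewrite scalerA => /(frame_free uv1)[-> /eqP]; rewrite mulf_eq0 (negPf t0) orbF => /eqP.
move: (t *: v1) uv2 yR1B => {v1 uv1 t t0} v1 uv1 yR1B.
have fe0 : f (qf A yu) = 0 by rewrite e0 rmorph0.
(* If k = 0, a nonzero a with m a + m' a' = 0 gives a singular point (a, 0). *)
have k0 : polar yu (conj yu) != 0.
  apply/eqP => k0; pose m := polar yu yR1.
  have [a a0 ma] : exists2 a, a != 0 & m * a + f m * f a = 0.
    have [m0|m0] := eqVneq m 0; first by exists 1; rewrite ?oner_eq0 // m0 rmorph0 !mul0r addr0.
    have [d d0 fd] := skew_exists fK fth; exists (d / m); first by rewrite mulf_neq0 ?invr_eq0.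
    by rewrite fmorph_div fd mulrC divfK // mulrC divfK ?fmorph_eq0 // subrr.
  have f0 := rmorph0 f.
  apply: (nonsingular (plane_vec_real yu yR1B a f0)).
  - by apply: contra_neq a0 => /(plane_vec_eq0 uv1 (erefl u) yR1B f0)[].
  - by rewrite (qf_plane_vec yu yR1B) fe0 e0 k0; ring.
  move=> z /(plane_vecP uv1 (erefl u) yR1B)[a' [r [_ ->]]].
  by rewrite (polar_plane_vec yu yR1B) fe0 e0 k0 ma; ring.
set k := polar yu (conj yu) in k0.
have fk : f k = k := polar_conj_fix yu.
(* Replacing v1 by v1 + mu u adds k mu' to the coefficient [polar yu yR1]; this [mu] cancels it. *)
pose mu := f (- polar yu yR1 / k); pose v := v1 + mu *: u.
pose yR := yR1 + (mu *: yu + conj (mu *: yu)).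
have yRB : yR *m B = v + conj v.
  rewrite mulmxDl yR1B mulmxDl -[in conj _ *m B]rB -map_mxM -scalemxAl -/u.
  by rewrite /v map_mxD addrACA.
have uv : frame u v.
  have [_ v1g] := frame_sub uv1.
  apply: frame_intro; rewrite ?addmx_sub ?scalemx_sub // => a c.
  have -> : a *: u + c *: v = (a + c * mu) *: u + c *: v1.
    by rewrite /v; apply/rowP=> i; rewrite !mxE; ring.
  by move/(frame_free uv1)=> [+ c0]; rewrite c0 mul0r addr0.
have m0 : polar yu yR = 0.
  rewrite /yR map_mxZ !polarDr !polarZr polar_diag e0 /mu fK -/k !addr0 mulr0 add0r.
  by rewrite divfK // subrr.
have fn := qf_real_fix yRB; set n := qf A yR in fn.
have qE a r : qf A (plane_vec yu yR a r) = k * (a * f a) + n * r ^+ 2.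
  by rewrite (qf_plane_vec yu yRB) fe0 e0 m0 rmorph0 -/k -/n; ring.
have n0 : n != 0.
  apply/eqP=> n0; have f1 := rmorph1 f.
  apply: (nonsingular (plane_vec_real yu yRB 0 f1)).
  - by apply/eqP => /(plane_vec_eq0 uv (erefl u) yRB f1)[_ /eqP]; rewrite oner_eq0.
  - by rewrite qE n0; ring.
  move=> z /(plane_vecP uv (erefl u) yRB)[a' [r [_ ->]]].
  by rewrite (polar_plane_vec yu yRB) fe0 e0 m0 !rmorph0 -/n n0; ring.
(* A rational point satisfies k a a' = - n r^2 with a and r nonzero, so scaling u by a / r turns the
   form into n (r^2 - a a'). *)
have [y [/realmxP ry y0 qy]] : exists y, [/\ Defs.realmx q y, y != 0 & qf A y = 0].
  by apply: ternary_form_isotropic; case: hB.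
have [a [r [fr yE]]] := plane_vecP uv (erefl u) yRB ry.
have kn : k * (a * f a) = - n * r ^+ 2.
  by apply/eqP; rewrite mulNr -addr_eq0 -qE -yE qy.
have r0 : r != 0.
  apply: contraNneq y0 => r0; move/eqP: kn.
  rewrite r0 expr0n mulr0 !mulf_eq0 (negPf k0) fmorph_eq0 orbb => /eqP a0.
  by rewrite yE r0 a0 /plane_vec rmorph0 !scale0r !addr0.
have a0 : a != 0.
  apply: contraNneq r0 => a0; move/eqP: kn.
  by rewrite a0 mul0r mulr0 eq_sym mulf_eq0 oppr_eq0 (negPf n0) expf_eq0.
have c0 : a / r != 0 by rewrite mulf_neq0 ?invr_eq0.
exists ((a / r) *: u), v, ((a / r) *: yu), yR; split=> //.
- have [_ vg] := frame_sub uv.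
  apply: frame_intro; rewrite ?scalemx_sub // => x z.
  by rewrite scalerA => /(frame_free uv)[/eqP + ->]; rewrite mulf_eq0 (negPf c0) orbF => /eqP.
- by rewrite -scalemxAl.
move=> x s fs.
have -> : plane_vec ((a / r) *: yu) yR x s = plane_vec yu yR (x * (a / r)) s.
  by rewrite /plane_vec map_mxZ !scalerA (rmorphM f x).
have -> : qf A (plane_vec yu yR (x * (a / r)) s) = n * (s ^+ 2 - x * f x).
  rewrite qE rmorphM fmorph_div fr.
  have -> : k * (x * (a / r) * (f x * (f a / r))) = k * (a * f a) * (x * f x / r ^+ 2).
    by field.
  by rewrite kn; field.
split=> [/eqP|->]; last by rewrite subrr mulr0.
by rewrite mulf_eq0 (negPf n0) subr_eq0 eq_sym => /eqP.
Qed.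

Lemma special_conic_baer : g_special q g B A ->
  exists b, baer_subline q g b /\ lines_meeting q S B A = lines_of S b.
Proof.
case/special_conic_circle=> u [v [yu [yR [uv yuB yRB circle]]]].
(* As 1 and [th] form a basis of [K] over GF(q), the GF(q)-combinations of ub and vb are exactly the
   z' u + z v. *)
pose ub := u + v; pose vb := f th *: u + th *: v.
have uvb : frame ub vb.
  have [ug vg] := frame_sub uv.
  apply: frame_intro; rewrite ?addmx_sub ?scalemx_sub // => a c.
  have -> : a *: ub + c *: vb = (a + c * f th) *: u + (a + c * th) *: v.
    by apply/rowP=> i; rewrite !mxE; ring.
  case/(frame_free uv) => E1 E2.
  have /eqP : c * (f th - th) = 0.
    by transitivity ((a + c * f th) - (a + c * th)); [ring | rewrite E1 E2 subrr].
  rewrite mulf_eq0 subr_eq0 (negPf fth) orbF => /eqP c0.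
  by move: E2; rewrite c0 mul0r addr0.
have bvecP w : baer_vector ub vb w <-> exists z, w = f z *: u + z *: v.
  split=> [[a [c [fa fc ->]]]|[z ->]].
    exists (a + c * th); rewrite rmorphD rmorphM fa fc.
    by apply/rowP=> i; rewrite !mxE; ring.
  have [s [t [fs ft ->]]] := real_coords fK fth z; exists s, t; split=> //.
  by rewrite rmorphD rmorphM fs ft; apply/rowP=> i; rewrite !mxE; ring.
pose b : {set 'M[K]_4} := [set P | [exists ac : K * K,
  [&& Fq q ac.1, Fq q ac.2, ac != (0, 0) & P == <<(ac.1 *: ub + ac.2 *: vb)%R>>%MS]]].
have hb P : P \in b <-> exists a c : K,
    [/\ Fq q a, Fq q c, (a, c) != (0, 0) & P = <<a *: ub + c *: vb>>%MS].
  rewrite inE; split=> [/existsP[[a c] /and4P[Fa Fc ac /eqP->]]|[a [c [Fa Fc ac ->]]]].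
    by exists a, c.
  by apply/existsP; exists (a, c); rewrite /= Fa Fc ac eqxx.
exists b; split; first by exists ub, vb.
have vecM := plane_vecM yuB yRB.
apply/setP=> l; apply/idP/idP => [|/(lines_of_baerP uvb hb)[w [/bvecP[z ->] w0 ->]]].
  rewrite inE => /andP[lS /existsP[P /andP[/existsP[y /and4P[/realmxP ry y0 /eqP qy /eqP ->]]]]].
  have [a [r [fr yE]]] := plane_vecP uv yuB yRB ry.
  have Na : a * f a = r ^+ 2 by apply/circle; rewrite // -yE.
  have r0 : r != 0.
    apply: contraNneq y0 => r0; move/eqP: Na.
    rewrite r0 expr0n mulf_eq0 fmorph_eq0 orbb => /eqP a0.
    by rewrite yE r0 a0 /plane_vec rmorph0 !scale0r !addr0.
  rewrite genmxE yE vecM // => Pl.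
  have x0 : a *: u + r *: v != 0 by rewrite frame_neq0 // r0 orbT.
  rewrite (spread_line_eq _ _ x0 lS Pl) ?frame_comb //.
  (* By a a' = r^2 the quotient a / r has norm 1, so it is z' / z for some z, and a u + r v is a
     multiple of the Baer vector z' u + z v. *)
  have [|z z0 fz] := hilbert90 fK fth (x := a / r).
    by rewrite fmorph_div fr mulrACA Na -invfM divff // expf_neq0.
  apply/(lines_of_baerP uvb hb); exists (f z *: u + z *: v); split.
  - by apply/bvecP; exists z.
  - by rewrite frame_neq0 // z0 orbT.
  have -> : f z *: u + z *: v = (z / r) *: (a *: u + r *: v).
    by rewrite fz scalerDr !scalerA divfK //; congr (_ *: _ + _); field.
  by rewrite conj_spanZ // mulf_neq0 ?invr_eq0.
have wg := frame_comb (f z) z uv.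
have z0 : z != 0 by apply: contraNneq w0 => z0; rewrite z0 rmorph0 !scale0r addr0.
have fN : f (z * f z) = z * f z by rewrite rmorphM fK mulrC.
rewrite inE conj_span_spread //=; apply/existsP.
(* The pair (z'^2, z z') satisfies a a' = r^2, and its point is z' w + z w' for w = z' u + z v. *)
exists (<<(plane_vec yu yR (f z ^+ 2) (z * f z) *m B)%R>>%MS); apply/andP; split.
  apply/existsP; exists (plane_vec yu yR (f z ^+ 2) (z * f z)).
  apply/and4P; split=> //.
  - exact/realmxP/(plane_vec_real yu yRB).
  - apply/eqP => /(plane_vec_eq0 uv yuB yRB fN)[_ /eqP].
    by rewrite mulf_eq0 fmorph_eq0 orbb (negPf z0).
  - by apply/eqP/circle; rewrite // rmorphXn fK; ring.
rewrite genmxE vecM //; apply/conj_spanP; exists (f z), z.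
have -> : f z ^+ 2 *: u + (z * f z) *: v = f z *: (f z *: u + z *: v).
  by rewrite scalerDr !scalerA [f z * z]mulrC.
by rewrite [conj (f z *: _)]map_mxZ fK.
Qed.
End Plane.
End Spread.

(** * Both directions of the correspondence *)

Lemma frob_nontrivial (K : finFieldType) (q : nat) :
  #|K| = (q ^ 2)%N -> exists x : K, frob q x != x.
Proof.
move=> hK; apply/existsP; apply: contraT; rewrite negb_exists => /forallP allF.
have K_gt1 := finNzRing_gt1 K; have := card_Fq hK.
rewrite (_ : #|_| = #|K|); last by apply: eq_card => x; have := allF x; rewrite negbK !inE /Fq.
rewrite hK; move: K_gt1; rewrite hK; case: (q) => [|[|m]] // _.
by rewrite -[RHS]expn1 => /eqP; rewrite eqn_exp2l.
Qed.

Theorem theorem3p1 (K : finFieldType) (q : nat) (S : {set 'M[K]_4})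
  (g : 'M[K]_4) (hK : #|K| = (q ^ 2)%N)
  (hS : regular_spread q S) (hg : g_transversal q S g) :
  (forall b : {set 'M[K]_4}, baer_subline q g b ->
     forall (B : 'M[K]_(3, 4)) (A : 'M[K]_3), nondeg_conic q B A ->
       (forall l, l \in lines_of S b -> ~~ (l <= B)%MS) ->
       conic_in q B A (lines_of S b) ->
       g_special q g B A) /\
  (forall (B : 'M[K]_(3, 4)) (A : 'M[K]_3), nondeg_conic q B A ->
     g_special q g B A ->
     [/\ regulus q (lines_meeting q S B A),
         lines_meeting q S B A \subset S,
         conic_in q B A (lines_meeting q S B A),
         (forall R, regulus q R -> R \subset S -> conic_in q B A R ->
            R = lines_meeting q S B A) &
         exists b, baer_subline q g b /\ lines_meeting q S B A = lines_of S b]).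
Proof.
have [f fE] := frob_rmorphism hK.
have fK : involutive f by move=> x; rewrite !fE frobK.
have [th fth] : exists th, f th != th.
  by have [th] := frob_nontrivial hK; exists th; rewrite fE.
have {hS} [hS _] := hS.
split=> [b hb B A hB|B A hB special]; first exact: (baer_conic_special fE fK fth hS hg hK hB hb).
have [b [hb eq_b]] := special_conic_baer fE fK fth hS hg hK hB special.
have reg : regulus q (lines_meeting q S B A).
  rewrite eq_b; have [u [v [/= uv hbP]]] := hb.
  exact: (regulus_lines_of_baer fE fK fth hS hg uv hbP hK).
have inS : lines_meeting q S B A \subset S.
  by apply/subsetP=> l; rewrite inE => /andP[].
have [_ [_ unique_line]] := conj I hS.
have realpt_cpt P : cpt q B A P -> realpt q P.
  case/existsP=> y /and4P[/(realmxP fE) ry y0 _ /eqP->].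
  have [/(realmxP fE) rB rkB _ _] := hB.
  apply: (realpt_genmx fE); last by rewrite map_mxM ry rB.
  by rewrite mulmx_free_eq0 // /row_free rkB.
split=> //; last by exists b.
- move=> P cP; have [l [[lS Pl] _]] := unique_line P (realpt_cpt P cP).
  by exists l => //; rewrite inE lS; apply/existsP; exists P; rewrite cP.
(* Only one spread line passes through each point of the conic, so [R] contains every spread line
   meeting it; both reguli have q + 1 lines. *)
move=> R [cardR _] RS inR; apply/esym/eqP; rewrite eqEcard cardR.
have [-> _] := reg; rewrite leqnn andbT; apply/subsetP=> l.
rewrite inE => /andP[lS /existsP[P /andP[cP Pl]]].
have [l' l'R Pl'] := inR P cP.
have [l0 [_ uniq_l0]] := unique_line P (realpt_cpt P cP).
by rewrite -(uniq_l0 l) // (uniq_l0 l') //; split=> //; apply: (subsetP RS).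
Qed.
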